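(* Let $\mathfrak T$ be a tower type of degree $n$, let $1\le i,j,k<n$ be integers, and let $\mathcal C$ be a set of isomorphism classes of degree $n$ number fields. Then $\mathrm{Spe}\big(\bigcup_{K\in\mathcal C}\mathcal S(\mathfrak T,K)\big)\subseteq\{\mathbf x\in\mathbb R^{n-1}: x_k\le x_i+x_j\}$ if and only if there exists a constant $c_{\mathfrak T,\mathcal C}>0$ depending only on $\mathfrak T$ and $\mathcal C$ such that $\lambda_k(\mathcal O)\le c_{\mathfrak T,\mathcal C}\lambda_i(\mathcal O)\lambda_j(\mathcal O)$ for all $\mathcal O\in\bigcup_{K\in\mathcal C}\mathcal S(\mathfrak T,K)$.
   Context: For a degree $n$ number field with embeddings $\sigma_m$, $|x|=\sqrt{\frac1n\sum_m|\sigma_m(x)|^2}$; for a full rank lattice $\Lambda$, $\lambda_i(\Lambda)=\min\{r>0:\dim_{\mathbb Q}\mathrm{Span}_{\mathbb Q}\{x\in\Lambda:|x|\le r\}\ge i+1\}$. A tower type is a tuple $(n_1,\dots,n_t)$ of integers $>1$, degree $\prod n_s$; the tower type of an order $\mathcal O$ in $K$ is $([K_1:K_0],\dots,[K_t:K_{t-1}])$ where $\mathbb Q=K_0\subset\dots\subset K_t=K$ are exactly the fields of the form $\mathbb Q(\{x\in\mathcal O:|x|\le r\})$, $r>0$. $\mathcal S(\mathfrak T,K)$ is the set of isomorphism classes of orders in $K$ with tower type $\mathfrak T$. Let $\Delta=\Delta_{\mathcal O}$ be the absolute value of the discriminant. For an infinite set $\mathcal S$ of isomorphism classes of orders in degree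 $n$ number fields, if the limit $\lim_{\mathcal O\in\mathcal S}(\log_\Delta\lambda_1(\mathcal O),\dots,\log_\Delta\lambda_{n-1}(\mathcal O))$ exists in $\mathbb R^{n-1}$ (with $\mathcal O$ ranging over $\mathcal S$, $\Delta_{\mathcal O}\to\infty$), it is called the Minkowski type $\mathbf x_{\mathcal S}$. The successive minima spectrum is $\mathrm{Spe}(\mathcal S)=\{\mathbf x\in\mathbb R^{n-1}:\exists$ infinite $\mathcal S'\subseteq\mathcal S$ with $\mathbf x_{\mathcal S'}=\mathbf x\}$. *)

(* Defs.v *)
From HB Require Import structures.
From mathcomp Require Import all_boot all_order all_algebra all_field.
From mathcomp Require Import complex.
From mathcomp Require Import boolp classical_sets functions cardinality fsbigop.
From mathcomp Require Import reals sequences exp.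

Set Implicit Arguments.
Unset Strict Implicit.
Unset Printing Implicit Defensive.

Import Order.TTheory GRing.Theory Num.Theory.

Local Open Scope classical_set_scope.
Local Open Scope ring_scope.

(* A number field is a [fieldExtType rat], of degree [\dim {:K}]. *)

Section NumberField.
Variable K : fieldExtType rat.

Definition embeddings (R : realType) : set (K -> R[i]) :=
  range (fun s : {rmorphism K -> R[i]} => s : K -> R[i]).

Definition nf_norm (R : realType) (x : K) : R :=
  Num.sqrt ((\dim {:K})%:R^-1 *
            \sum_(s \in @embeddings R) Normc.normc (s x) ^+ 2).

Definition bounded_part (R : realType) (L : set K) (r : R) : set K :=
  [set x | L x /\ nf_norm R x <= r].

Definition is_Qspan (A : set K) (V : {vspace K}) : Prop :=
  (forall x, A x -> x \in V) /\
  forall W : {vspace K}, (forall x, A x -> x \in W) -> (V <= W)%VS.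

Definition is_Qadjoin (A : set K) (F : {subfield K}) : Prop :=
  (forall x, A x -> x \in F) /\
  forall E : {subfield K}, (forall x, A x -> x \in E) -> (F <= E)%VS.

(* For a lattice [L] and [i < \dim {:K}] the infimum is a minimum, because
   [L] has finitely many elements of bounded norm. *)
Definition succ_min (R : realType) (L : set K) (i : nat) : R :=
  inf [set r : R | 0 < r /\
        exists V, is_Qspan (bounded_part L r) V /\ (i.+1 <= \dim V)%N].

Definition Zbasis (L : set K) (e : (\dim {:K}).-tuple K) : Prop :=
  basis_of {:K} e /\
  forall x, L x <->
    exists c : 'I_(\dim {:K}) -> int, x = \sum_i tnth e i *~ c i.

Definition full_lattice (L : set K) : Prop := exists e, Zbasis L e.

Definition is_order (O : set K) : Prop :=
  [/\ O 1, forall x y, O x -> O y -> O (x * y) & full_lattice O].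

Definition nf_trace (x : K) : rat :=
  \tr (passmx.mxof (vbasis {:K}) (vbasis {:K}) (amull x)).

Definition basis_disc (e : (\dim {:K}).-tuple K) : rat :=
  \det (\matrix_(i, j) nf_trace (tnth e i * tnth e j)).

(* All integral bases of [L] give the same value. *)
Definition abs_disc (L : set K) : rat :=
  xget 0 [set d | exists2 e, Zbasis L e & d = `|basis_disc e|].

(* [T] lists the degrees [K_1 : K_0], ..., [K_t : K_{t-1}], with [t = size T]
   and [Ks s] for [K_s]. *)
Definition has_tower_type (R : realType) (O : set K) (T : seq nat) : Prop :=
  exists Ks : nat -> {subfield K},
    [/\ Ks 0%N = 1%AS, Ks (size T) = {:K}%AS,
        forall s, (s < size T)%N ->
          [/\ (Ks s <= Ks s.+1)%VS, Ks s <> Ks s.+1 &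
              \dim_(Ks s) (Ks s.+1) = nth 0%N T s] &
        forall F : {subfield K},
          (exists2 s, (s <= size T)%N & F = Ks s) <->
          (exists r : R, 0 < r /\ is_Qadjoin (bounded_part O r) F)].

End NumberField.

Definition nf_iso (K K' : fieldExtType rat) : Prop :=
  exists f : {rmorphism K -> K'}, bijective f.

Definition nf_iso_closed (C : fieldExtType rat -> Prop) : Prop :=
  forall K K', nf_iso K K' -> C K -> C K'.

Record nf_order := NfOrder {
  order_field : fieldExtType rat;
  order_set : set order_field;
  order_setP : is_order order_set }.
Arguments order_set : clear implicits.

Definition order_iso (O O' : nf_order) : Prop :=
  exists f : order_field O -> order_field O',
    [/\ set_bij (order_set O) (order_set O') f,
        f 1 = 1,
        forall x y, order_set O x -> order_set O y -> f (x + y) = f x + f y &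
        forall x y, order_set O x -> order_set O y -> f (x * y) = f x * f y].

(* A set of isomorphism classes of orders is an isomorphism-invariant
   predicate on orders (likewise for number fields). *)
Definition order_iso_closed (S : nf_order -> Prop) : Prop :=
  forall O O', order_iso O O' -> S O -> S O'.

Definition finitely_many_classes (S : nf_order -> Prop) : Prop :=
  exists (m : nat) (f : 'I_m -> nf_order),
    forall O, S O -> exists l, order_iso (f l) O.

Section Spectrum.
Variable R : realType.

Definition lambda (O : nf_order) (i : nat) : R := succ_min R (order_set O) i.

Definition Delta (O : nf_order) : R := ratr (abs_disc (order_set O)).

Definition logb (b x : R) : R := ln x / ln b.

(* Coordinate [m : 'I_n.-1] of a vector of R^(n-1), counted from 0,
   corresponds to lambda_(m+1).  On an infinite set of isomorphism classes of
   orders of degree [n], [Delta] is unbounded, so that the limit is unique. *)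
Definition has_minkowski_type n (S : nf_order -> Prop)
    (x : 'rV[R]_n.-1) : Prop :=
  forall eps : R, 0 < eps -> exists D : R, forall O, S O -> D < Delta O ->
    forall m : 'I_n.-1, `|logb (Delta O) (lambda O m.+1) - x 0 m| < eps.

Definition Spe n (S : nf_order -> Prop) : set 'rV[R]_n.-1 :=
  [set x | exists S' : nf_order -> Prop,
     [/\ order_iso_closed S', forall O, S' O -> S O,
         ~ finitely_many_classes S' & has_minkowski_type S' x]].

Definition orders_of_type (T : seq nat) (C : fieldExtType rat -> Prop)
    (O : nf_order) : Prop :=
  C (order_field O) /\ has_tower_type R (order_set O) T.

End Spectrum.
Arguments Spe R n S : clear implicits.

Definition is_tower_type (T : seq nat) : Prop := all (fun m => (1 < m)%N) T.

Definition tower_degree (T : seq nat) : nat := (\prod_(m <- T) m)%N.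

(* Main.v *)
Require Import Defs.
From HB Require Import structures.
From mathcomp Require Import all_boot all_order all_algebra all_field.
From mathcomp Require Import all_fingroup complex.
From mathcomp Require Import boolp classical_sets functions fsbigop.
From mathcomp Require Import reals sequences exp.
From mathcomp Require Import ring lra zify.
(* imported again because [order_set] is also a name of [fingraph] *)
Require Import Defs.

Set Implicit Arguments.
Unset Strict Implicit.
Unset Printing Implicit Defensive.

Import Order.TTheory GRing.Theory Num.Theory.

Local Open Scope classical_set_scope.
Local Open Scope ring_scope.

(* If x_k > x_i + x_j for a point of the spectrum, then lambda_k is larger than
   any multiple of lambda_i lambda_j along the corresponding orders, because
   their discriminants are unbounded: by reduction theory an order has an
   integral basis bounded in terms of its degree and discriminant, and the traces
   of products of two and three basis elements, which are bounded integers,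
   determine the structure constants.

   Conversely, one order O with lambda_k > c lambda_i lambda_j, for a large
   constant c depending on the degree only, yields a point of the spectrum with
   x_k > x_i + x_j. Take a basis 1 = x_0, x_1, ... of the field adapted to the
   successive minima. If the coordinate of x_a x_b along x_l does not vanish,
   then lambda_l <= C lambda_a lambda_b, so that A_l := log_2 (C lambda_l),
   suitably rounded, satisfies A_l <= A_a + A_b for all such triples, whereas
   A_k > A_i + A_j. Hence the lattices O_M with basis 1, D M^(A_l) x_l are orders
   (D is a common denominator), lambda_l(O_M) is of the order of M^(A_l), and the
   Minkowski type of this family is A_l / (2 (A_1 + ... + A_(n-1))). The A_l are
   made strictly increasing, and each x_l is chosen by the primitive element
   theorem so that the span of x_0, ..., x_l generates one of the fields in the
   tower of O; so O_M has the tower type of O. *)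

(** * Reduction of positive definite forms *)

Lemma det_intr_sqr (R : comNzRingType) n (U : 'M[int]_n) :
  U \in unitmx -> \det (map_mx intr U : 'M[R]_n) ^+ 2 = 1.
Proof.
rewrite unitmxE det_map_mx -rmorphXn /= => hU.
have /orP[/eqP-> | /eqP->] : (\det U == 1) || (\det U == -1) by exact: hU.
  by rewrite expr1n.
by rewrite sqrrN expr1n.
Qed.

Section GramChange.
Variable R : comNzRingType.

(** The rows of [U] hold the coordinates of the new vectors. For the Gram matrix [G] of a basis this
    is the Gram matrix after the change of basis [U]. *)
Definition gram_change n (G : 'M[R]_n) (U : 'M[int]_n) : 'M[R]_n :=
  map_mx intr U *m G *m (map_mx intr U)^T.

Lemma gram_changeM n (G : 'M[R]_n) (U V : 'M[int]_n) :
  gram_change (gram_change G U) V = gram_change G (V *m U).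
Proof. by rewrite /gram_change map_mxM /= trmx_mul !mulmxA. Qed.

Lemma gram_change1 n (G : 'M[R]_n) : gram_change G 1%:M = G.
Proof. by rewrite /gram_change map_mx1 mul1mx trmx1 mulmx1. Qed.

Lemma det_gram_change n (G : 'M[R]_n) (U : 'M[int]_n) :
  U \in unitmx -> \det (gram_change G U) = \det G.
Proof.
move=> /(@det_intr_sqr R) h; rewrite /gram_change !det_mulmx det_tr.
by rewrite mulrAC -expr2 h mul1r.
Qed.

Lemma gram_change_sym n (G : 'M[R]_n) U :
  G^T = G -> (gram_change G U)^T = gram_change G U.
Proof. by move=> h; rewrite /gram_change !trmx_mul trmxK h mulmxA. Qed.

Lemma gram_change_tperm n (G : 'M[R]_n.+1) (i : 'I_n.+1) :
  gram_change G (tperm_mx 0 i) 0 0 = G i i.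
Proof.
rewrite /gram_change /tperm_mx map_perm_mx -row_permE tr_perm_mx -col_permE.
by rewrite !mxE tpermL.
Qed.

(** Only biadditivity of [b] is assumed, so that this covers both the rational trace form and the
    real form [nf_form]. *)
Lemma gram_change_form (V : zmodType) n (b : V -> V -> R) (e e' : 'I_n -> V)
    (P : 'M[int]_n) :
  (forall y, zmod_morphism (b^~ y)) -> (forall x, zmod_morphism (b x)) ->
  (forall i, e' i = \sum_j e j *~ P i j) ->
  \matrix_(i, j) b (e' i) (e' j) = gram_change (\matrix_(i, j) b (e i) (e j)) P.
Proof.
move=> bl br he.
pose bL y : {additive V -> R} :=
  HB.pack (b^~ y) (GRing.isZmodMorphism.Build _ _ _ (bl y)).
pose bR x : {additive V -> R} :=
  HB.pack (b x) (GRing.isZmodMorphism.Build _ _ _ (br x)).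
have addl y I (r : seq I) (f : I -> V) :
  b (\sum_(i <- r) f i) y = \sum_(i <- r) b (f i) y by exact: (raddf_sum (bL y)).
have addr x I (r : seq I) (f : I -> V) :
  b x (\sum_(i <- r) f i) = \sum_(i <- r) b x (f i) by exact: (raddf_sum (bR x)).
have mull x y z : b (x *~ z) y = z%:~R * b x y.
  by rewrite mulrzl; exact: (raddfMz (bL y)).
have mulr x y z : b x (y *~ z) = z%:~R * b x y.
  by rewrite mulrzl; exact: (raddfMz (bR x)).
apply/matrixP => i j; rewrite !mxE !he addl.
under eq_bigr do rewrite addr.
rewrite exchange_big; apply: eq_bigr => k _; rewrite !mxE big_distrl /=.
by apply: eq_bigr => l _; rewrite mull mulr !mxE; ring.
Qed.
End GramChange.

Section Reduction.
Variable R : realType.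

Lemma nearest_int (x : R) : exists t : int, (t%:~R + x) ^+ 2 <= 4^-1.
Proof.
exists (- Num.floor (x + 2^-1)).
have /andP[] := floor_itv (x + 2^-1).
move: (Num.floor _) => f; rewrite intrD intrN => h1 h2; nra.
Qed.

(** The infimum of the diagonal values is at least [mu], hence positive, and some value lies within
    a third of it above. A permutation moves that value to the first place. *)
Lemma near_minimal_basis n (mu : R) (G : 'M[R]_n.+1) : 0 < mu ->
  (forall U i, U \in unitmx -> mu <= gram_change G U i i) ->
  exists2 U0, U0 \in unitmx & forall U i, U \in unitmx ->
    3 / 4 * gram_change G U0 0 0 <= gram_change G U i i.
Proof.
move=> mu0 hmu.
pose E := [set r : R | exists U i, U \in unitmx /\ r = gram_change G U i i].
have hlb : lbound E mu by move=> _ [U [i [hU ->]]]; exact: hmu.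
have hE : has_inf E.
  split; last by exists mu.
  exists (gram_change G 1%:M 0 0); exists 1%:M, 0; split=> //; exact: unitmx1.
have hinf : mu <= inf E by apply: lb_le_inf => //; case: hE.
have h3 : 0 < inf E / 3 by lra.
have [_ [U0 [i0 [hU0 ->]]] hlt] := inf_adherent h3 hE.
exists (tperm_mx 0 i0 *m U0); first by rewrite unitmx_mul unitmx_perm.
move=> U i hU; rewrite -gram_changeM gram_change_tperm.
have : inf E <= gram_change G U i i by apply: ge_inf; [exists mu | exists U, i].
lra.
Qed.

(** Hermite's induction on the dimension: split off an almost shortest vector, reduce the projection
    orthogonal to it, and lift. The lower bound [mu] on all diagonal values plays the role of the
    squared minimum of the lattice. *)
Lemma basis_reduction n (mu D : R) : 0 < mu -> 0 <= D ->
  exists B, forall G : 'M[R]_n.+1, G^T = G ->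
    (forall U i, U \in unitmx -> mu <= gram_change G U i i) -> \det G <= D ->
    exists2 U, U \in unitmx & forall i, gram_change G U i i <= B.
Proof.
elim: n mu D => [|n IH] mu D mu0 D0.
  exists D => G _ _; rewrite det_mx11 => hD; exists 1%:M; first exact: unitmx1.
  by move=> i; rewrite gram_change1 ord1.
(* With [g >= mu] the square length of the first vector, lifting adds at most [g / 4]. So the
   projected lattice has values at least [3g/4 - g/4 = g/2 >= mu/2], and its determinant is that of
   [G] divided by [g]. *)
have [B hB] := IH (mu / 2) (D / mu) ltac:(lra) ltac:(by rewrite divr_ge0 // ltW).
exists (2 * B) => G symG hmu hD.
have [U0 hU0 hmin] := near_minimal_basis mu0 hmu.
pose G0 : 'M[R]_(1 + n.+1) := gram_change G U0.
have symG0 : G0^T = G0 by exact: gram_change_sym.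
have hG0 U i : U \in unitmx -> 3 / 4 * G0 0 0 <= gram_change G0 U i i.
  by move=> hU; rewrite /G0 gram_changeM; apply: hmin; rewrite unitmx_mul hU.
have hg : mu <= G0 0 0 by exact: hmu.
set g := G0 0 0 in hG0 hg; have g0 : 0 < g by exact: lt_le_trans hg.
pose h : 'rV[R]_n.+1 := ursubmx G0.
have eG0 : G0 = block_mx g%:M h h^T (drsubmx G0).
  rewrite -[LHS]submxK; congr block_mx; last by rewrite /h trmx_ursub symG0.
  rewrite [LHS]mx11_scalar; congr (_%:M); rewrite 2!mxE /g; congr (G0 _ _); exact/val_inj.
pose G' : 'M[R]_n.+1 := drsubmx G0 - g^-1 *: (h^T *m h).
pose P : 'M[R]_(1 + n.+1) := block_mx 1%:M 0 (g^-1 *: h^T) 1%:M.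
have ePG : G0 = P *m block_mx g%:M 0 0 G' *m P^T.
  rewrite /P tr_block_mx !trmx1 trmx0 !mulmx_block !mul1mx !mul0mx !mulmx0.
  rewrite !mulmx1 !addr0 !add0r {1}eG0 mul_scalar_mx mul_mx_scalar linearZ /=.
  rewrite trmxK !scalerA mulfV ?gt_eqF // !scale1r; congr block_mx.
  by rewrite -scalemxAr /G' addrC subrK.
have symG' : G'^T = G'.
  rewrite /G' linearB linearZ /= trmx_mul trmxK; congr (_ - _).
  by rewrite trmx_drsub symG0.
have detG : \det G = g * \det G'.
  have -> : \det G = \det G0 by rewrite -(det_gram_change G hU0).
  rewrite ePG !det_mulmx det_tr /P det_lblock !det1.
  by rewrite !mul1r mulr1 det_ublock det_scalar1.
(* size reduction: completing [U'] by a first column makes the off-diagonal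
   coefficients at most 1/2 *)
have lift U' : U' \in unitmx -> exists2 U : 'M[int]_(1 + n.+1), U \in unitmx &
    gram_change G0 U 0 0 = g /\ forall i,
    gram_change G0 U (rshift 1 i) (rshift 1 i) <= g / 4 + gram_change G' U' i i.
  move=> hU'.
  have [s es] : exists s : 'cV[R]_n.+1, map_mx intr U' *m (g^-1 *: h^T) = s.
    by eexists.
  have /choice[t ht] : forall i, exists t : int, (t%:~R + s i 0) ^+ 2 <= 4^-1.
    by move=> i; exact: nearest_int.
  pose T : 'cV[int]_n.+1 := \col_i t i.
  exists (block_mx 1%:M 0 T U').
    by rewrite unitmxE det_lblock det1 mul1r -unitmxE.
  have -> : gram_change G0 (block_mx 1%:M 0 T U') = block_mx g%:M
      (g *: (map_mx intr T + s)^T) (g *: (map_mx intr T + s))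
      (g *: ((map_mx intr T + s) *m (map_mx intr T + s)^T) + gram_change G' U').
    rewrite /gram_change ePG map_block_mx map_mx1 map_mx0 !mulmxA.
    rewrite -(mulmxA _ P^T) -trmx_mul.
    have -> : block_mx 1%:M 0 (map_mx intr T) (map_mx intr U') *m P =
       block_mx 1%:M 0 (map_mx intr T + s) (map_mx intr U').
      by rewrite /P mulmx_block !mul1mx !mul0mx !mulmx0 !mulmx1 !addr0 !add0r es.
    rewrite tr_block_mx trmx1 trmx0 !mulmx_block !mul1mx !mul0mx !mulmx0.
    rewrite !mulmx1 !addr0 !add0r mul_scalar_mx mul_mx_scalar.
    by rewrite -scalemxAl mul0mx addr0.
  split.
    have -> : 0 = lshift n.+1 (0 : 'I_1) by exact/val_inj.
    by rewrite block_mxEul mxE.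
  move=> i; rewrite block_mxEdr !mxE big_ord1 !mxE lerD2r -expr2 ler_pM2l //.
have hG' U' i : U' \in unitmx -> g / 2 <= gram_change G' U' i i.
  move=> /lift[U hU [_ /(_ i)]]; have := hG0 U (rshift 1 i) hU; lra.
have [U' i /hG' h'| |U' hU' hB'] := hB G' symG'.
- by apply: le_trans (h' i); lra.
- rewrite ler_pdivlMr //; have [h0|h0] := leP (\det G') 0.
    by apply: le_trans D0; rewrite mulr_le0_ge0 // ltW.
  by apply: le_trans hD; rewrite detG mulrC ler_pM2r.
have [U hU [e0 hUi]] := lift _ hU'.
exists (U *m U0); first by rewrite unitmx_mul hU.
have gB : g / 2 <= B by apply: le_trans (hB' 0); exact: hG'.
move=> i; rewrite -gram_changeM -/G0.
case: (@split_ordP 1 n.+1 i) => k ->.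
  have -> : lshift n.+1 k = 0 by apply/val_inj; rewrite /= ord1.
  rewrite e0; lra.
have := hUi k; have := hB' k; lra.
Qed.
End Reduction.

(** * Embeddings, trace and norm *)

Section Coordinates.
Variables (F : fieldType) (V : vectType F) (n : nat) (e : n.-tuple V).
Hypothesis he : basis_of fullv e.

Lemma coord_sum (x : V) : x = \sum_i coord e i x *: tnth e i.
Proof.
rewrite {1}(coord_basis he (memvf x)); apply: eq_bigr => i _.
by rewrite (tnth_nth 0).
Qed.

Lemma coord_comb (c : 'I_n -> F) i : coord e i (\sum_j c j *: tnth e j) = c i.
Proof.
rewrite -[RHS](coord_sum_free c i (basis_free he)); congr (coord _ _ _).
by apply: eq_bigr => j _; rewrite (tnth_nth 0).
Qed.

Lemma coord_tnth i j : coord e i (tnth e j) = (i == j)%:R.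
Proof. by rewrite (tnth_nth 0) coord_free ?(basis_free he) // eq_sym. Qed.
End Coordinates.

Definition mulmat (K : fieldExtType rat) n (e : n.-tuple K) (x : K) : 'M[rat]_n :=
  \matrix_(i, j) coord e j (tnth e i * x).

(** Expanding in the other basis turns either trace into the same double sum. *)
Lemma trace_mulmat_basis (K : fieldExtType rat) n n' (e : n.-tuple K)
    (e' : n'.-tuple K) (x : K) : basis_of fullv e -> basis_of fullv e' ->
  \tr (mulmat e x) = \tr (mulmat e' x).
Proof.
move=> he he'; rewrite /mxtrace.
transitivity (\sum_i \sum_k coord e i (tnth e' k) * coord e' k (tnth e i * x)).
  apply: eq_bigr => i _; rewrite mxE {1}(coord_sum he' (tnth e i * x)) linear_sum.
  by apply: eq_bigr => k _; rewrite linearZ /= mulrC.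
rewrite exchange_big; apply: eq_bigr => k _; rewrite mxE /=.
rewrite {2}(coord_sum he (tnth e' k)) mulr_suml linear_sum.
by apply: eq_bigr => i _; rewrite -scalerAl linearZ.
Qed.

Lemma nf_trace_vbasis (K : fieldExtType rat) (x : K) :
  nf_trace x = \tr (mulmat (vbasis {:K}) x).
Proof.
rewrite /nf_trace; congr (\tr _); apply/matrixP => i j; rewrite !mxE /=.
congr (coord _ _ _); rewrite lfunE /= mulrC; congr (_ * _).
rewrite /passmx.vecof (bigD1 i) //= mxE !eqxx scale1r big1 => [|k ki].
  by rewrite addr0 -tnth_nth.
by rewrite mxE eqxx (negbTE ki) scale0r.
Qed.

Lemma nf_traceE (K : fieldExtType rat) n (e : n.-tuple K) x :
  basis_of fullv e -> nf_trace x = \tr (mulmat e x).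
Proof.
by move=> he; rewrite nf_trace_vbasis; apply: trace_mulmat_basis; rewrite ?vbasisP.
Qed.

Lemma rat_alg_map_poly (K : fieldExtType rat) (L : fieldType)
    (f : {rmorphism K -> L}) (x : K) (q : {poly rat}) :
  f (horner_alg x q) = (map_poly ratr q).[f x].
Proof.
rewrite /horner_alg /horner_morph -horner_map -map_poly_comp; congr (_.[_]).
by apply: eq_map_poly => a /=; rewrite alg_num_field fmorph_rat.
Qed.

Lemma nf_primitive (K : fieldExtType rat) : exists z : K, <<1; z>>%VS = fullv.
Proof.
have h : separable 1 {:K}.
  apply/separableP => x _; apply: pcharf0_separable => p.
  by rewrite pchar_lalg pchar_num.
by exists (separable_generator 1 {:K}); rewrite -eq_adjoin_separable_generator ?sub1v.
Qed.

Lemma horner_alg_onto (K : fieldExtType rat) (z : K) : <<1; z>>%VS = fullv ->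
  forall x, exists q : {poly rat}, horner_alg z q = x.
Proof.
move=> hz x; have hx : x \in <<1; z>>%VS by rewrite hz memvf.
have /polyOver1P[q hq] := Fadjoin_polyOver 1 z x.
by exists q; rewrite -[RHS](Fadjoin_poly_eq hx) hq.
Qed.

(** Every element is [q(z)] for some [q], and it is sent to [q(r)]. This does not depend on [q]: two
    choices differ by a multiple of the minimal polynomial [p], which vanishes at [r]. *)
Lemma embedding_of_root (K : fieldExtType rat) (L : numFieldType) (z : K)
    (p : {poly rat}) (r : L) :
  <<1; z>>%VS = fullv -> map_poly (in_alg K) p = minPoly 1 z ->
  root (map_poly ratr p) r ->
  exists f : {rmorphism K -> L}, forall q, f (horner_alg z q) = (map_poly ratr q).[r].
Proof.
move=> hz hp hr; have [Q hQ] := choice (horner_alg_onto hz).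
pose f x := (map_poly ratr (Q x)).[r].
have ev q q' : horner_alg z q = horner_alg z q' ->
    (map_poly ratr q).[r] = (map_poly ratr q').[r] :> L.
  move=> /eqP; rewrite -subr_eq0 -rmorphB /= => h0.
  apply/eqP; rewrite -subr_eq0 -hornerN -hornerD -rmorphN -rmorphD /=.
  have : p %| q - q'.
    rewrite -(dvdp_map (in_alg K)) hp; apply: minPoly_dvdp => //.
    by apply/polyOver1P; exists (q - q').
  rewrite -(dvdp_map (@ratr L)) => /dvdpP[u ->].
  by rewrite hornerM (rootP hr) mulr0.
have fadd : zmod_morphism f.
  move=> x y; rewrite /f -hornerN -hornerD -rmorphN -rmorphD /=; apply: ev.
  by rewrite hQ rmorphB /= !hQ.
have fmul : monoid_morphism f.
  split=> [|x y]; first by rewrite -[RHS](hornerC 1 r) polyC1 -(rmorph1 (map_poly ratr));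
    apply: ev; rewrite hQ rmorph1.
  by rewrite /f -hornerM -rmorphM /=; apply: ev; rewrite rmorphM /= !hQ.
pose fA := GRing.isZmodMorphism.Build _ _ f fadd.
pose fM := GRing.isMonoidMorphism.Build _ _ f fmul.
pose g : {rmorphism K -> L} := HB.pack f fA fM.
by exists g => q; apply: ev; rewrite hQ.
Qed.

Section Embeddings.
Variables (R : realType) (K : fieldExtType rat) (n : nat).

Definition embmat (s : 'I_n -> {rmorphism K -> R[i]}) (e : n.-tuple K) : 'M[R[i]]_n :=
  \matrix_(m, j) s m (tnth e j).

(** Besides listing the embeddings without repetition, [s] carries their linear independence, in the
    form of invertible embedding matrices. *)
Definition enumerates (s : 'I_n -> {rmorphism K -> R[i]}) : Prop :=
  [/\ injective (fun m => s m : K -> R[i]),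
      @embeddings K R = range (fun m => s m : K -> R[i]) &
      forall e : n.-tuple K, basis_of fullv e -> embmat s e \in unitmx].

(** The embeddings correspond to the roots of the minimal polynomial of a primitive element. There
    are [n] of them because the polynomial has degree [n] and is separable. *)
Lemma enumerates_exists : \dim {:K} = n -> exists s, enumerates s.
Proof.
move=> dimK; have [z hz] := nf_primitive K.
have /polyOver1P[p hp] := minPolyOver 1 z.
have [r hr] := closed_field_poly_normal (map_poly ratr p : {poly R[i]}).
have p0 : p != 0.
  by rewrite -(map_poly_eq0 (in_alg K)) -hp monic_neq0 ?monic_minPoly.
have lc0 : lead_coef (map_poly ratr p : {poly R[i]}) != 0.
  by rewrite lead_coef_eq0 map_poly_eq0.
have rootr x : root (map_poly ratr p) x = (x \in r).
  by rewrite hr rootZ // root_prod_XsubC.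
have sz_r : size r = n.
  apply/eqP; rewrite -eqSS -(size_prod_XsubC r id) -(size_scale _ lc0) -hr.
  rewrite size_map_poly -(size_map_poly (in_alg K)) -hp size_minPoly eqSS.
  by rewrite -dimK -hz dim_Fadjoin dimv1 muln1.
have uniq_r : uniq r.
  rewrite -separable_prod_XsubC -(eqp_separable (eqp_scale _ lc0)) -hr separable_map.
  rewrite -(separable_map (in_alg K)) -hp.
  by apply: pcharf0_separable => q; rewrite pchar_lalg pchar_num.
pose a (m : 'I_n) := r`_m.
have ha (m : 'I_n) : root (map_poly ratr p) (a m) by rewrite rootr mem_nth ?sz_r.
have a_inj : injective a.
  move=> m m' /eqP; rewrite nth_uniq ?sz_r // => /eqP; exact: val_inj.
have [s hs] := choice (fun m => embedding_of_root hz (esym hp) (ha m)).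
have sz m : s m z = a m.
  by rewrite -{1}(horner_algX z) hs map_polyX hornerX.
exists s; split.
- by move=> m m' /(congr1 (fun f => f z)); rewrite !sz => /a_inj.
- apply/seteqP; split=> [_ [f _ <-]|_ [m _ <-]]; last by exists (s m).
  have : root (map_poly ratr p) (f z).
    rewrite /root -rat_alg_map_poly fmorph_eq0; have := root_minPoly 1 z.
    by rewrite hp.
  rewrite rootr => /(nthP 0)[m]; rewrite sz_r => mn hm.
  exists (Ordinal mn) => //; apply/funext => x.
  have [q <-] := horner_alg_onto hz x.
  by rewrite !rat_alg_map_poly sz /a /= hm.
move=> e he.
(* [P] expresses the powers of [z] in the basis [e], so that [embmat s e *m P] is a transposed
   Vandermonde matrix at the distinct roots. Its nonzero determinant forces that of [embmat s e] to
   be nonzero. *)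
pose P : 'M[R[i]]_n := \matrix_(j, k) ratr (coord e j (z ^+ k)).
have : embmat s e *m P = (Vandermonde n (\row_m a m))^T.
  apply/matrixP => m k; rewrite !mxE -sz -rmorphXn [in RHS](coord_sum he (z ^+ k)).
  rewrite rmorph_sum; apply: eq_bigr => j _; by rewrite !mxE rmorphZ_num mulrC.
move=> /(congr1 determinant); rewrite det_mulmx det_tr det_Vandermonde => hd.
rewrite unitmxE unitfE; have : \det (embmat s e) * \det P != 0.
  rewrite hd; apply/prodf_neq0 => m _; apply/prodf_neq0 => m' lt.
  rewrite !mxE subr_eq0; apply: contraTneq lt => /a_inj ->; by rewrite ltnn.
by apply: contraNneq => ->; rewrite mul0r.
Qed.

Variable s : 'I_n -> {rmorphism K -> R[i]}.
Hypothesis hs : enumerates s.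

Lemma sum_embeddings (A : zmodType) (f : (K -> R[i]) -> A) :
  \sum_(t \in @embeddings K R) f t = \sum_m f (s m).
Proof.
have [inj -> _] := hs.
rewrite fsbig_image; last by move=> m m' _ _; exact: inj.
have e : [set` enum 'I_n] = setT.
  by apply/seteqP; split=> m //= _; rewrite mem_enum.
by rewrite -big_enum (fsbig_seq _ _ (enum_uniq _)) e.
Qed.

Lemma nf_normE x : nf_norm R x =
  Num.sqrt ((\dim {:K})%:R^-1 * \sum_m Normc.normc (s m x) ^+ 2).
Proof. by rewrite /nf_norm sum_embeddings. Qed.

(** All multiplications are diagonalised simultaneously by the embedding matrix. Hence trace and
    determinant of [mulmat e x] become the sum and the product of the conjugates of [x]. *)
Lemma mulmat_embmat (e : n.-tuple K) x : basis_of fullv e ->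
  embmat s e *m (map_mx ratr (mulmat e x))^T = diag_mx (\row_m s m x) *m embmat s e.
Proof.
move=> he; apply/matrixP => m j; rewrite mul_diag_mx !mxE mulrC -rmorphM /=.
rewrite [in RHS](coord_sum he (_ * _)) rmorph_sum; apply: eq_bigr => k _.
by rewrite !mxE rmorphZ_num mulrC.
Qed.

Lemma map_mulmat_conj (e : n.-tuple K) x : basis_of fullv e ->
  (map_mx ratr (mulmat e x))^T =
    invmx (embmat s e) *m diag_mx (\row_m s m x) *m embmat s e.
Proof.
move=> he; have [_ _ /(_ _ he) hu] := hs.
by rewrite -mulmxA -mulmat_embmat // mulmxA mulVmx // mul1mx.
Qed.

Lemma trace_mulmat (e : n.-tuple K) x : basis_of fullv e ->
  ratr (\tr (mulmat e x)) = \sum_m s m x.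
Proof.
move=> he; have [_ _ /(_ _ he) hu] := hs.
rewrite -trace_map_mx -mxtrace_tr map_mulmat_conj // mxtrace_mulC mulmxA.
rewrite mulmxV // mul1mx mxtrace_diag; by apply: eq_bigr => m _; rewrite mxE.
Qed.

Lemma det_mulmat (e : n.-tuple K) x : basis_of fullv e ->
  ratr (\det (mulmat e x)) = \prod_m s m x.
Proof.
move=> he; have [_ _ /(_ _ he) hu] := hs.
rewrite -det_map_mx -det_tr map_mulmat_conj // !det_mulmx mulrAC.
rewrite -det_mulmx mulVmx // det1 mul1r det_diag.
by apply: eq_bigr => m _; rewrite mxE.
Qed.

End Embeddings.

(** * Integral bases and the discriminant *)

Section Lattices.
Variable K : fieldExtType rat.

(** This is [Zbasis] with a free length [n], so that orders in different fields of one degree share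
    an index type. *)
Definition zbasis n (L : set K) (e : n.-tuple K) : Prop :=
  basis_of {:K} e /\
  forall x, L x <-> exists c : 'I_n -> int, x = \sum_i tnth e i *~ c i.

Lemma zbasis_coord n (L : set K) (e : n.-tuple K) x : zbasis L e ->
  L x <-> exists c : 'I_n -> int, forall i, coord e i x = (c i)%:~R.
Proof.
move=> [he hL]; rewrite hL; split=> -[c hc]; exists c.
  move=> i; rewrite hc -[RHS](coord_comb he (fun i => (c i)%:~R)); congr (coord _ _ _).
  by apply: eq_bigr => j _; rewrite scaler_int.
rewrite {1}(coord_sum he x); apply: eq_bigr => j _.
by rewrite hc scaler_int.
Qed.

Lemma zbasis_mem n (L : set K) (e : n.-tuple K) i : zbasis L e -> L (tnth e i).
Proof.
move=> he; apply/(zbasis_coord _ he); exists (fun j => (j == i)%:R : int) => j.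
by rewrite (coord_tnth he.1); case: eqP.
Qed.

(** The transition matrices in the two directions are integral and inverse to each other. *)
Lemma zbasis_change n (L : set K) (e e' : n.-tuple K) : zbasis L e -> zbasis L e' ->
  exists2 P : 'M[int]_n, P \in unitmx &
    forall i, tnth e' i = \sum_j tnth e j *~ P i j.
Proof.
have get (f f' : n.-tuple K) : zbasis L f -> zbasis L f' ->
    exists P : 'M[int]_n, forall i j, coord f j (tnth f' i) = (P i j)%:~R.
  move=> hf hf'; have /choice[c hc] : forall i, exists c : 'I_n -> int,
      forall j, coord f j (tnth f' i) = (c j)%:~R.
    by move=> i; apply/(zbasis_coord _ hf); exact: zbasis_mem.
  by exists (\matrix_(i, j) c i j) => i j; rewrite mxE.
move=> he he'; have [P hP] := get _ _ he he'; have [Q hQ] := get _ _ he' he.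
have PQ : P *m Q = 1%:M.
  apply/matrixP => i k; apply: (intr_inj (R := rat)); rewrite !mxE rmorph_sum /=.
  have -> : ((i == k)%:R : int)%:~R = coord e' k (tnth e' i).
    by rewrite (coord_tnth he'.1) eq_sym; case: eqP.
  rewrite [in RHS](coord_sum he.1 (tnth e' i)) linear_sum /=.
  by apply: eq_bigr => j _; rewrite linearZ /= hP hQ -intrM.
exists P; first by have [] := mulmx1_unit PQ.
move=> i; rewrite (coord_sum he.1 (tnth e' i)).
by apply: eq_bigr => j _; rewrite hP scaler_int.
Qed.

Lemma zbasis_mulmat n (O : set K) (e : n.-tuple K) x : zbasis O e ->
  (forall x y, O x -> O y -> O (x * y)) -> O x ->
  exists M : 'M[int]_n, mulmat e x = map_mx intr M.
Proof.
move=> he hM Ox; have /choice[c hc] : forall i, exists c : 'I_n -> int,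
    forall j, coord e j (tnth e i * x) = (c j)%:~R.
  by move=> i; apply/(zbasis_coord _ he); apply: hM => //; exact: zbasis_mem.
by exists (\matrix_(i, j) c i j); apply/matrixP => i j; rewrite !mxE hc.
Qed.

Lemma nf_trace_int n (O : set K) (e : n.-tuple K) x : zbasis O e ->
  (forall x y, O x -> O y -> O (x * y)) -> O x ->
  exists t : int, nf_trace x = t%:~R.
Proof.
move=> he hM Ox; have [M hMx] := zbasis_mulmat he hM Ox.
by exists (\tr M); rewrite (nf_traceE _ he.1) hMx trace_map_mx.
Qed.

Definition disc n (e : n.-tuple K) : rat :=
  \det (\matrix_(i, j) nf_trace (tnth e i * tnth e j)).

Lemma nf_trace_zmod : zmod_morphism (@nf_trace K).
Proof.
move=> x y; rewrite !nf_trace_vbasis -raddfB /=; congr (\tr _).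
by apply/matrixP => i j; rewrite !mxE mulrBr linearB.
Qed.

Lemma disc_change n (L : set K) (e e' : n.-tuple K) :
  zbasis L e -> zbasis L e' -> disc e' = disc e.
Proof.
move=> he he'; have [P hP eP] := zbasis_change he he'; rewrite /disc.
rewrite (gram_change_form (b := fun x y => nf_trace (x * y)) _ _ eP).
- exact: det_gram_change.
- by move=> y x x'; rewrite mulrBl nf_trace_zmod.
- by move=> y x x'; rewrite mulrBr nf_trace_zmod.
Qed.

(** The basis chosen by [xget] does not matter, by [disc_change]; the default 0 is excluded because
    [e] is a witness. *)
Lemma abs_discE (L : set K) n (e : n.-tuple K) : zbasis L e -> abs_disc L = `|disc e|.
Proof.
move=> he; have en : n = \dim {:K} by rewrite -(size_basis he.1).
subst n; rewrite /abs_disc; case: xgetP => [d _ [e' he' ->]|/(_ `|disc e|) []].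
  by rewrite -(disc_change he he').
by exists e.
Qed.
End Lattices.

(** * The norm, its bilinear form and the discriminant *)

Section Norm.
Variables (R : realType) (K : fieldExtType rat) (n : nat).
Variable s : 'I_n -> {rmorphism K -> R[i]}.
Hypothesis hs : enumerates s.
Hypothesis dimK : \dim {:K} = n.
Notation N := (@nf_norm K R).
Notation normc := Normc.normc.

Lemma degree_gt0 : (0 < n)%N.
Proof. by rewrite -dimK adim_gt0. Qed.
Let n0 : 0 < n%:R :> R. Proof. by rewrite ltr0n degree_gt0. Qed.

Lemma normc_ge0 (z : R[i]) : 0 <= normc z.
Proof. by case: z => a b; exact: sqrtr_ge0. Qed.

Lemma normcR (x : R) : normc x%:C%C = `|x|.
Proof. by rewrite /= expr0n addr0 sqrtr_sqr. Qed.

Lemma ratrC (a : rat) : ratr a = (ratr a : R)%:C%C.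
Proof. by rewrite -[LHS](fmorph_rat (real_complex R)). Qed.

Lemma normc_ratr (a : rat) : normc (ratr a) = `|ratr a : R|.
Proof. by rewrite ratrC normcR. Qed.

Lemma normc_prod (f : 'I_n -> R[i]) : normc (\prod_i f i) = \prod_i normc (f i).
Proof.
exact: (big_morph (@normc R) (@Normc.normcM R) (@Normc.normc1 R)).
Qed.

Lemma normc_sum I (r : seq I) (f : I -> R[i]) :
  normc (\sum_(i <- r) f i) <= \sum_(i <- r) normc (f i).
Proof.
elim: r => [|i r IH]; first by rewrite !big_nil Normc.normc0.
rewrite !big_cons; apply: le_trans (le_normcD _ _) _; by rewrite lerD2l.
Qed.

Lemma nf_norm_ge0 x : 0 <= N x. Proof. exact: sqrtr_ge0. Qed.

Lemma nf_norm_sqr x : N x ^+ 2 = n%:R^-1 * \sum_m normc (s m x) ^+ 2.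
Proof.
rewrite (nf_normE hs) dimK sqr_sqrtr // mulr_ge0 ?invr_ge0 ?(ltW n0) //.
by apply: sumr_ge0 => m _; exact: sqr_ge0.
Qed.

Lemma nf_norm1 : N 1 = 1.
Proof.
apply/eqP; rewrite -(@eqrXn2 _ 2) ?ler01 ?nf_norm_ge0 // nf_norm_sqr expr1n.
under eq_bigr => m _ do rewrite rmorph1 Normc.normc1 expr1n.
by rewrite sumr_const card_ord mulVf // gt_eqF.
Qed.

Lemma nf_normZ a x : N (a *: x) = `|ratr a| * N x.
Proof.
apply/eqP; rewrite -(@eqrXn2 _ 2) ?nf_norm_ge0 ?mulr_ge0 ?nf_norm_ge0 //.
rewrite exprMn !nf_norm_sqr mulrCA; apply/eqP; congr (_ * _).
rewrite mulr_sumr; apply: eq_bigr => m _.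
by rewrite rmorphZ_num Normc.normcM normc_ratr exprMn.
Qed.

(** One term of the sum defining the norm is at most the whole sum. This gives the factor [sqrt n],
    weakened to [n] to avoid roots. *)
Lemma normc_le x m : normc (s m x) <= n%:R * N x.
Proof.
have nN : 0 <= n%:R * N x by rewrite mulr_ge0 ?nf_norm_ge0 ?(ltW n0).
rewrite -(@ler_pXn2r _ 2) ?nnegrE ?normc_ge0 // exprMn nf_norm_sqr.
rewrite mulrA expr2 mulfK ?gt_eqF //.
apply: (@le_trans _ _ (\sum_m normc (s m x) ^+ 2)).
  by rewrite (bigD1 m) //= lerDl; apply: sumr_ge0 => k _; exact: sqr_ge0.
rewrite ler_peMl ?ler1n ?degree_gt0 //.
by apply: sumr_ge0 => k _; exact: sqr_ge0.
Qed.

Lemma nf_norm_le x B : 0 <= B -> (forall m, normc (s m x) <= B) -> N x <= B.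
Proof.
move=> B0 hB; rewrite -(@ler_pXn2r _ 2) ?nnegrE ?nf_norm_ge0 // nf_norm_sqr.
rewrite mulrC ler_pdivrMr // -[n in n%:R]card_ord mulr_natr -sumr_const.
by apply: ler_sum => m _; rewrite ler_pXn2r ?nnegrE ?normc_ge0.
Qed.

Lemma nf_normM x y : N (x * y) <= n%:R ^+ 2 * (N x * N y).
Proof.
have -> : n%:R ^+ 2 * (N x * N y) = (n%:R * N x) * (n%:R * N y) by ring.
apply: nf_norm_le => [|m]; first by rewrite !mulr_ge0 ?nf_norm_ge0 ?(ltW n0).
by rewrite rmorphM Normc.normcM ler_pM ?normc_ge0 ?normc_le.
Qed.

(** Multiplication by [x] has a nonzero integral determinant, equal to the product of the
    conjugates. So the squared absolute values of the conjugates have product at least 1, and by the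
    inequality of the arithmetic and geometric means their average is at least 1. *)
Lemma order_norm_ge1 (O : set K) (e : n.-tuple K) x : zbasis O e ->
  (forall x y, O x -> O y -> O (x * y)) -> O x -> x != 0 -> 1 <= N x.
Proof.
move=> he hM Ox x0; have [M hMx] := zbasis_mulmat he hM Ox.
have hdet := det_mulmat hs x he.1; rewrite hMx det_map_mx /= in hdet.
have d0 : \det M != 0.
  apply: contraNneq x0 => d0; move: hdet; rewrite d0 rmorph0 => /esym/eqP.
  by move=> /prodf_eq0[m _]; rewrite fmorph_eq0.
have hprod : 1 <= \prod_m normc (s m x) ^+ 2.
  rewrite prodrXl -normc_prod -hdet normc_ratr ratr_int real_normK ?num_real //.
  rewrite -rmorphXn /= ler1z; move: d0; case: (\det M) => k; nia.
have := leif_AGM (A := predT) (E := fun m => normc (s m x) ^+ 2)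
  (fun m _ => sqr_ge0 _).
rewrite card_ord => -[+ _]; rewrite mulrC -nf_norm_sqr => /(le_trans hprod) h1.
rewrite leNgt; apply/negP => lt1; move: h1; rewrite leNgt -exprM => /negP; apply.
by rewrite exprn_ilt1 ?nf_norm_ge0 // muln_eq0 /= -lt0n degree_gt0.
Qed.

(** The inverse of the embedding matrix recovers the coordinates from the conjugates, which are
    bounded by the norm. *)
Lemma coord_bound (e : n.-tuple K) : basis_of fullv e ->
  exists2 c, 0 < c & forall x i, `|ratr (coord e i x)| <= c * N x.
Proof.
move=> he; have [_ _ /(_ _ he) hu] := hs; set S := embmat s e in hu.
pose c := 1 + \sum_i \sum_m normc (invmx S i m) * n%:R.
have c_ge i : \sum_m normc (invmx S i m) * n%:R <= c.
  have h j : 0 <= \sum_m normc (invmx S j m) * n%:R.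
    by apply: sumr_ge0 => m _; rewrite mulr_ge0 ?normc_ge0 ?(ltW n0).
  rewrite /c [X in _ <= 1 + X](bigD1 i) //= addrCA lerDl addr_ge0 //.
  by apply: sumr_ge0 => j _; exact: h.
exists c; first by rewrite ltr_pwDl // sumr_ge0 // => i _; apply: sumr_ge0 => m _;
  rewrite mulr_ge0 ?normc_ge0 ?(ltW n0).
move=> x i; pose v : 'cV[R[i]]_n := \col_j ratr (coord e j x).
have hv : S *m v = \col_m s m x.
  apply/matrixP => m j; rewrite !mxE [in RHS](coord_sum he x) rmorph_sum /=.
  by apply: eq_bigr => k _; rewrite !mxE rmorphZ_num mulrC.
have hvi : ratr (coord e i x) = \sum_m invmx S i m * s m x.
  have -> : ratr (coord e i x) = v i 0 by rewrite mxE.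
  rewrite -[v](mulKmx hu) hv mxE; by apply: eq_bigr => m _; rewrite mxE.
rewrite -normc_ratr hvi; apply: le_trans (normc_sum _ _) _.
apply: le_trans (ler_wpM2r (nf_norm_ge0 x) (c_ge i)); rewrite mulr_suml.
apply: ler_sum => m _; rewrite Normc.normcM -mulrA ler_wpM2l ?normc_ge0 //.
exact: normc_le.
Qed.

Lemma ratr_disc (e : n.-tuple K) : basis_of fullv e ->
  ratr (disc e) = \det (embmat s e) ^+ 2.
Proof.
move=> he; have -> : \det (embmat s e) ^+ 2 = \det ((embmat s e)^T *m embmat s e).
  by rewrite det_mulmx det_tr expr2.
rewrite -det_map_mx; congr (\det _).
apply/matrixP => i j; rewrite !mxE (nf_traceE _ he) /= (trace_mulmat hs _ he).
by apply: eq_bigr => m _; rewrite !mxE rmorphM.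
Qed.

Lemma disc_neq0 (e : n.-tuple K) : basis_of fullv e -> disc e != 0.
Proof.
move=> he; have [_ _ /(_ _ he)] := hs; rewrite unitmxE unitfE.
apply: contraNneq => d0; have := ratr_disc he; rewrite d0 rmorph0 => /esym/eqP.
by rewrite expf_eq0.
Qed.

(** The polarisation of the squared norm. Taking real parts gives values in [R] at once; by
    [nf_formE] the sum is real anyway. *)
Definition nf_form (x y : K) : R :=
  n%:R^-1 * \sum_m complex.Re (s m x * conjc (s m y)).

Lemma nf_form_sqr x : nf_form x x = N x ^+ 2.
Proof.
rewrite nf_norm_sqr /nf_form; congr (_ * _); apply: eq_bigr => m _.
case: (s m x) => a b /=; rewrite sqr_sqrtr ?addr_ge0 ?sqr_ge0 //; ring.
Qed.

Lemma nf_formC x y : nf_form x y = nf_form y x.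
Proof.
rewrite /nf_form; congr (_ * _); apply: eq_bigr => m _.
by case: (s m x) (s m y) => a b [c d] /=; ring.
Qed.

Lemma nf_form_zmod y : zmod_morphism (nf_form^~ y).
Proof.
move=> x x'; rewrite /nf_form -mulrBr -sumrB; congr (_ * _); apply: eq_bigr => m _.
by rewrite rmorphB mulrBl raddfB.
Qed.

(** Complex conjugation permutes the embeddings, so the sum is fixed by it. *)
Lemma nf_formE x y :
  (nf_form x y)%:C%C = n%:R^-1 * \sum_m s m x * conjc (s m y).
Proof.
pose f (t : K -> R[i]) := t x * conjc (t y).
have conj_bij : set_bij (@embeddings K R) (@embeddings K R)
    (fun t z => conjc (t z)).
  split=> [_ [t _ <-]|t t' _ _ h|_ [t _ <-]].
  - by exists (@conjc R \o t).
  - by apply/funext => z; apply: (can_inj (@conjcK R)); move/(congr1 (@^~ z)): h.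
  - exists (@conjc R \o t); first by exists (@conjc R \o t).
    by apply/funext => z /=; rewrite conjcK.
have hreal : conjc (\sum_m f (s m)) = \sum_m f (s m).
  rewrite -(sum_embeddings hs f) [in RHS](reindex_fsbig _ _ _ _ conj_bij).
  rewrite (sum_embeddings hs f) (sum_embeddings hs (fun t => f (fun z => conjc (t z)))).
  by rewrite rmorph_sum; apply: eq_bigr => m _; rewrite /f rmorphM.
have -> : \sum_m s m x * conjc (s m y) = (\sum_m complex.Re (f (s m)))%:C%C.
  rewrite -(raddf_sum (@complex.Re R)) -/f; move: hreal; case: (\sum_m _) => a b /=.
  by move=> [h]; congr (_ +i* _)%C; lra.
by rewrite /nf_form rmorphM /= fmorphV rmorph_nat.
Qed.

(** With [S] the embedding matrix, the Gram matrix is [S^T] times the conjugate of [S], divided by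
    [n]. Its determinant is therefore the absolute discriminant divided by [n ^ n]. *)
Lemma det_nf_form (e : n.-tuple K) : basis_of fullv e ->
  \det (\matrix_(i, j) nf_form (tnth e i) (tnth e j)) <= `|ratr (disc e)|.
Proof.
move=> he; set G := \matrix_(i, j) _.
have hG : map_mx (real_complex R) G =
    n%:R^-1 *: ((embmat s e)^T *m map_mx (@conjc R) (embmat s e)).
  apply/matrixP => i j; rewrite !mxE nf_formE; congr (_ * _).
  by apply: eq_bigr => m _; rewrite !mxE.
(* The determinant of [S] need not be real; only its square is known to be the rational
   discriminant, so squares are compared. *)
have hsq : \det G ^+ 2 = (n%:R ^- n * ratr (disc e)) ^+ 2.
  apply: (fmorph_inj (real_complex R)).
  have hd : (\det G)%:C%C =
      n%:R ^- n * (\det (embmat s e) * conjc (\det (embmat s e))).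
    by rewrite -[LHS]det_map_mx hG detZ det_mulmx det_tr det_map_mx exprVn.
  have hz : \det (embmat s e) ^+ 2 = (ratr (disc e))%:C%C.
    by rewrite -ratr_disc // ratrC.
  have hc : conjc (\det (embmat s e)) ^+ 2 = (ratr (disc e))%:C%C.
    by rewrite -rmorphXn /= hz conjc_real.
  move: hz hc; move: (ratr (disc e) : R) => z hz hc.
  rewrite [LHS](rmorphXn (real_complex R)) /= hd !exprMn hz hc.
  rewrite -expr2 -!exprMn; have -> : n%:R ^- n = (n%:R ^- n : R)%:C%C :> R[i].
    by rewrite (fmorphV (real_complex R)) (rmorphXn (real_complex R)) /= rmorph_nat.
  by rewrite -(rmorphM (real_complex R)) -(rmorphXn (real_complex R)).
apply: le_trans (ler_norm _) _.
have -> : `|\det G| = `|n%:R ^- n * ratr (disc e)|.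
  by apply/eqP; rewrite -(@eqrXn2 _ 2) ?normr_ge0 // !real_normK ?num_real // hsq.
rewrite normrM ler_piMl ?normr_ge0 // ger0_norm ?invr_ge0 ?exprn_ge0 ?ler0n //.
by rewrite invf_le1 ?exprn_gt0 // exprn_ege1 // ler1n degree_gt0.
Qed.

End Norm.

(** * Isomorphisms and spans *)

Section StructureConstants.
Variables (K K' : fieldExtType rat) (n : nat) (e : n.-tuple K) (e' : n.-tuple K').
Hypotheses (he : basis_of fullv e) (he' : basis_of fullv e').
Hypothesis mul_eq : forall i j k,
  coord e k (tnth e i * tnth e j) = coord e' k (tnth e' i * tnth e' j).

Lemma iso_of_structure_constants : exists f : {rmorphism K -> K'},
  [/\ bijective f, forall i, f (tnth e i) = tnth e' i &
      forall x i, coord e' i (f x) = coord e i x].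
Proof.
pose f x := \sum_i coord e i x *: tnth e' i.
pose g x := \sum_i coord e' i x *: tnth e i.
have fK : cancel f g.
  by move=> x; rewrite {2}(coord_sum he x); apply: eq_bigr => i _; rewrite coord_comb.
have gK : cancel g f.
  by move=> x; rewrite {2}(coord_sum he' x); apply: eq_bigr => i _; rewrite coord_comb.
have fe i : f (tnth e i) = tnth e' i.
  rewrite /f (bigD1 i) //= coord_tnth // eqxx scale1r big1 ?addr0 // => j ji.
  by rewrite coord_tnth // (negbTE ji) scale0r.
have fadd : zmod_morphism f.
  move=> x y; rewrite /f -sumrB; apply: eq_bigr => i _.
  by rewrite linearB scalerBl.
pose fl : {additive K -> K'} := HB.pack f (GRing.isZmodMorphism.Build _ _ f fadd).
have fZ a x : f (a *: x) = a *: f x.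
  rewrite /f scaler_sumr; apply: eq_bigr => i _; by rewrite linearZ scalerA.
have fsum I (r : seq I) (F : I -> K) : f (\sum_(i <- r) F i) = \sum_(i <- r) f (F i).
  exact: (raddf_sum fl).
have fmul2 i j : f (tnth e i * tnth e j) = tnth e' i * tnth e' j.
  by rewrite (coord_sum he' (tnth e' i * _)); apply: eq_bigr => k _; rewrite mul_eq.
have fM : {morph f : x y / x * y}.
  move=> x y; rewrite {1}(coord_sum he x) {1}(coord_sum he y) !mulr_suml !fsum.
  apply: eq_bigr => i _; rewrite !mulr_sumr fsum.
  apply: eq_bigr => j _.
  by rewrite -!scalerAl -!scalerAr !fZ fmul2.
(* The unit need not belong to the basis, but [f 1] is a nonzero idempotent of a field. *)
have f1 : f 1 = 1.
  have nz : f 1 != 0.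
    apply/eqP => h; have := oner_neq0 K; rewrite -(fK 1) h.
    by rewrite /g big1 ?eqxx // => i _; rewrite linear0 scale0r.
  by apply: (mulfI nz); rewrite -fM !mulr1.
pose F : {rmorphism K -> K'} := HB.pack f
  (GRing.isZmodMorphism.Build _ _ f fadd) (GRing.isMonoidMorphism.Build _ _ f (f1, fM)).
exists F; split; [by exists g | by [] | by move=> x i; rewrite /= coord_comb].
Qed.
End StructureConstants.

Lemma zbasis_image (K K' : fieldExtType rat) n (L : set K) (L' : set K')
    (e : n.-tuple K) (e' : n.-tuple K') (f : K -> K') :
  zbasis L e -> zbasis L' e' -> (forall x i, coord e' i (f x) = coord e i x) ->
  forall x, L x <-> L' (f x).
Proof.
move=> he he' hf x; rewrite (zbasis_coord _ he) (zbasis_coord _ he').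
by split=> -[c hc]; exists c => i; rewrite -hc hf.
Qed.

Lemma order_zbasis (O : nf_order) n : \dim {:order_field O} = n ->
  exists e : n.-tuple (order_field O), zbasis (order_set O) e.
Proof. by move=> <-; have [_ _] := order_setP O. Qed.

Lemma order_mul (O : nf_order) x y :
  order_set O x -> order_set O y -> order_set O (x * y).
Proof. by have [_ h _] := order_setP O; exact: h. Qed.

Lemma order_iso_of_basis (O O' : nf_order) n (e : n.-tuple (order_field O))
    (e' : n.-tuple (order_field O')) :
  zbasis (order_set O) e -> zbasis (order_set O') e' ->
  (forall i j k, coord e k (tnth e i * tnth e j) = coord e' k (tnth e' i * tnth e' j)) ->
  order_iso O O'.
Proof.
move=> he he' hc; have [f [[g fK gK] fe fc]] := iso_of_structure_constants he.1 he'.1 hc.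
have fO := zbasis_image he he' fc.
exists f; split; [split|exact: rmorph1|by move=> *; exact: rmorphD|by move=> *; exact: rmorphM].
- by move=> x /fO.
- by move=> x y _ _; exact: fmorph_inj.
- by move=> y Oy; exists (g y); [apply/fO; rewrite gK|rewrite gK].
Qed.

Lemma common_denominator (I : finType) (a : I -> rat) :
  exists D : int, 0 < D /\ forall i, exists c : int, D%:~R * a i = c%:~R.
Proof.
exists (\prod_i denq (a i)); split; first by apply: prodr_gt0 => i _; exact: denq_gt0.
move=> i; rewrite (bigD1 i) //= mulrC intrM mulrA -{1}(divq_num_den (a i)).
exists (numq (a i) * \prod_(j | j != i) denq (a j)).
by rewrite mulfVK ?intr_eq0 ?denq_neq0 // intrM.
Qed.

Section LatticeGroup.
Variables (K : fieldExtType rat) (n : nat) (L : set K) (e : n.-tuple K).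
Hypothesis he : zbasis L e.

Lemma lattice_comb I (r : seq I) (x : I -> K) (c : I -> int) :
  (forall i, L (x i)) -> L (\sum_(i <- r) x i *~ c i).
Proof.
move=> hx; apply/(zbasis_coord _ he).
have /choice[d hd] i := (zbasis_coord _ he).1 (hx i).
exists (fun k => \sum_(i <- r) d i k * c i) => k.
rewrite linear_sum rmorph_sum; apply: eq_bigr => i _ /=.
by rewrite -scaler_int linearZ /= hd -intrM mulrC.
Qed.
End LatticeGroup.

Section OrderIso.
Variables (O O' : nf_order).

(** The map in [order_iso] is constrained only on the order, and its values elsewhere are arbitrary.
    It is additive on the lattice, so it carries an integral basis to an integral basis with the
    same structure constants; [order_iso_morphism] rebuilds a field isomorphism from these. *)
Lemma order_iso_basis : order_iso O O' ->
  exists n (e : n.-tuple (order_field O)) (e' : n.-tuple (order_field O')),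
  [/\ zbasis (order_set O) e, zbasis (order_set O') e' &
   forall i j k, coord e k (tnth e i * tnth e j) = coord e' k (tnth e' i * tnth e' j)].
Proof.
case=> f [[fO finj fsurj] f1 fD fM].
have [e he] := order_zbasis (erefl (\dim {:order_field O})).
have [b hb] := order_zbasis (erefl (\dim {:order_field O'})).
set n := \dim _ in e he.
have O0 : order_set O 0.
  by have := lattice_comb he [::] (fun=> 0) (fun i => zbasis_mem i he); rewrite big_nil.
have f0 : f 0 = 0 by apply: (addrI (f 0)); rewrite -fD // !addr0.
have OD x y : order_set O x -> order_set O y -> order_set O (x + y).
  move=> Ox Oy.
  have := lattice_comb he [:: true; false] (fun=> 1) (x := fun b => if b then x else y).
  by rewrite big_cons big_seq1 /=; apply; case.
have OMn x k : order_set O x -> order_set O (x *+ k).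
  by move=> Ox; elim: k => [|k IH]; rewrite ?mulr0n ?mulrS //; exact: OD.
have ON x : order_set O x -> order_set O (- x).
  move=> Ox; have := lattice_comb he [:: tt] (fun=> -1) (x := fun=> x) (fun=> Ox).
  by rewrite big_seq1 mulrN1z.
have fMn x k : order_set O x -> f (x *+ k) = f x *+ k.
  by move=> Ox; elim: k => [|k IH]; rewrite ?mulr0n ?mulrS // fD ?IH //; exact: OMn.
have fN x : order_set O x -> f (- x) = - f x.
  move=> Ox; apply: (addrI (f x)); rewrite -fD ?subrr //; exact: ON.
have OMz x k : order_set O x -> order_set O (x *~ k).
  by case: k => k Ox; rewrite ?NegzE ?mulrNz; [|apply: ON]; exact: OMn.
have fMz x k : order_set O x -> f (x *~ k) = f x *~ k.
  case: k => k Ox; first exact: fMn.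
  by rewrite NegzE !mulrNz fN ?fMn //; exact: OMn.
have fsum (r : seq 'I_n) (c : 'I_n -> int) :
    f (\sum_(i <- r) tnth e i *~ c i) = \sum_(i <- r) f (tnth e i) *~ c i.
  elim: r => [|i r IH]; first by rewrite !big_nil.
  rewrite !big_cons fD ?fMz ?IH //; try exact: zbasis_mem.
    by apply: OMz; exact: zbasis_mem.
  by apply: (lattice_comb he) => j; exact: zbasis_mem.
pose e' : n.-tuple (order_field O') := [tuple f (tnth e i) | i < n].
have e'E i : tnth e' i = f (tnth e i) by rewrite tnth_mktuple.
have hL y : order_set O' y <-> exists c : 'I_n -> int, y = \sum_i tnth e' i *~ c i.
  split=> [/fsurj[x Ox <-]|[c ->]].
    have [c ->] := (he.2 x).1 Ox; exists c; rewrite fsum.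
    by apply: eq_bigr => i _; rewrite e'E.
  have -> : \sum_i tnth e' i *~ c i = f (\sum_i tnth e i *~ c i).
    by rewrite fsum; apply: eq_bigr => i _; rewrite e'E.
  by apply: fO; apply/he.2; exists c.
have span_e' y : order_set O' y -> y \in <<e'>>%VS.
  move=> /hL[c ->]; apply: rpred_sum => i _; rewrite -scaler_int rpredZ //.
  by rewrite memv_span ?mem_tnth.
(* A rational relation between the images, cleared of denominators, says that [f] sends an element
   of the order to 0. Injectivity on the order makes that element 0. *)
have free_e' : free e'.
  apply/freeP => a ha; have [D [D0 hD]] := common_denominator a.
  have [c hc] := choice hD.
  have : f (\sum_i tnth e i *~ c i) = 0.
    transitivity ((D%:~R : rat) *: \sum_(i < n) a i *: e'`_i); last first.
      by rewrite ha scaler0.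
    rewrite fsum scaler_sumr.
    by apply: eq_bigr => i _; rewrite scalerA hc -tnth_nth e'E scaler_int.
  rewrite -f0 => /finj; rewrite !inE => /(_ _ O0) h0 i.
  have /(congr1 (coord e i)) : \sum_j tnth e j *~ c j = 0.
    by apply: h0; apply/he.2; exists c.
  have -> : \sum_j tnth e j *~ c j = \sum_j (c j)%:~R *: tnth e j.
    by apply: eq_bigr => j _; rewrite scaler_int.
  rewrite coord_comb ?he.1 // linear0 -hc => /eqP.
  by rewrite mulf_eq0 intr_eq0 gt_eqF //= => /eqP.
have he' : zbasis (order_set O') e'.
  split=> //; rewrite basisEfree free_e' subvf /=.
  have : (fullv <= <<e'>>)%VS.
    rewrite -(span_basis hb.1); apply/span_subvP => y /tnthP[i ->].
    by apply: span_e'; exact: zbasis_mem.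
  by move=> /dimvS/leq_trans; apply; exact: dim_span.
exists n, e, e'; split=> // i j k.
have Oij : order_set O (tnth e i * tnth e j) by apply: order_mul; exact: zbasis_mem.
have [c hc] := (he.2 _).1 Oij.
have comb m (L : fieldExtType rat) (x : m.-tuple L) (d : 'I_m -> int) :
    \sum_i tnth x i *~ d i = \sum_i (d i)%:~R *: tnth x i.
  by apply: eq_bigr => l _; rewrite scaler_int.
rewrite !e'E -fM ?hc ?fsum; try exact: zbasis_mem.
under [in RHS]eq_bigr do rewrite -e'E.
by rewrite !comb !coord_comb ?he.1 ?he'.1.
Qed.

Lemma order_iso_morphism : order_iso O O' ->
  exists f : {rmorphism order_field O -> order_field O'},
    bijective f /\ forall x, order_set O x <-> order_set O' (f x).
Proof.
move=> /order_iso_basis[n [e [e' [he he' hc]]]].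
have [f [bij_f _ fc]] := iso_of_structure_constants he.1 he'.1 hc.
by exists f; split=> //; exact: zbasis_image he he' fc.
Qed.

Lemma order_iso_abs_disc :
  order_iso O O' -> abs_disc (order_set O) = abs_disc (order_set O').
Proof.
move=> /order_iso_basis[n [e [e' [he he' hc]]]].
have [f [_ fe fc]] := iso_of_structure_constants he.1 he'.1 hc.
have htr x : nf_trace x = nf_trace (f x).
  rewrite (nf_traceE _ he.1) (nf_traceE _ he'.1); congr (\tr _).
  by apply/matrixP => i j; rewrite !mxE -fe -rmorphM fc.
rewrite (abs_discE he) (abs_discE he'); congr (`|\det _|).
by apply/matrixP => i j; rewrite !mxE htr rmorphM !fe.
Qed.
End OrderIso.

(** * Rational spans and the fields they generate *)

Section Spans.
Variable K : fieldExtType rat.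

(** A subspace of least dimension containing [A] lies in every other one, since their intersection
    cannot be smaller. *)
Lemma is_Qspan_exists (A : set K) : exists V, is_Qspan A V.
Proof.
pose P m := `[< exists V : {vspace K}, \dim V = m /\ forall x, A x -> x \in V >].
have exP : exists m, P m by exists (\dim {:K}); apply/asboolP; exists fullv; split=> // x _; exact: memvf.
case: (ex_minnP exP) => m /asboolP[V [dV hV]] hmin.
exists V; split=> // W hW; apply/capv_idPl/eqP; rewrite eqEdim capvSl /= dV.
apply: hmin; apply/asboolP; exists (V :&: W)%VS; split=> // x Ax.
by rewrite memv_cap hV // hW.
Qed.

Definition qspan (A : set K) : {vspace K} := xget 0%VS [set V | is_Qspan A V].

Lemma qspanP A : is_Qspan A (qspan A).
Proof. by rewrite /qspan; case: xgetP => [V -> //|h]; have [V /h] := is_Qspan_exists A. Qed.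

Lemma is_QspanE A V : is_Qspan A V -> V = qspan A.
Proof.
move=> [h1 h2]; have [q1 q2] := qspanP A; apply/eqP; rewrite eqEsubv.
by rewrite h2 // q2.
Qed.

Lemma mem_qspan A x : A x -> x \in qspan A.
Proof. by move=> Ax; have [h _] := qspanP A; exact: h. Qed.

Lemma qspan_sub A W : (qspan A <= W)%VS <-> forall x, A x -> x \in W.
Proof.
split=> [h x Ax|h]; first by apply: (subvP h); exact: mem_qspan.
by have [_] := qspanP A; exact.
Qed.

Definition generates (V : {vspace K}) (F : {subfield K}) : Prop :=
  (V <= F)%VS /\ forall E : {subfield K}, (V <= E)%VS -> (F <= E)%VS.

Lemma is_QadjoinE A F : is_Qadjoin A F <-> generates (qspan A) F.
Proof.
rewrite /is_Qadjoin /generates; split=> -[/qspan_sub h1 h2]; split=> // E /qspan_sub; exact: h2.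
Qed.

Lemma generates_exists V : exists F, generates V F.
Proof.
exists <<1 & vbasis V>>%AS; split=> [|E hE].
  by apply/subvP => x xV; rewrite (coord_vbasis xV); apply: rpred_sum => i _;
    apply: rpredZ; apply: seqv_sub_adjoin; exact: memt_nth.
apply/Fadjoin_seqP; split; first exact: sub1v.
by move=> x /vbasis_mem; exact: (subvP hE).
Qed.

Lemma generates_uniq V F F' : generates V F -> generates V F' -> F = F'.
Proof.
move=> [h1 h2] [h3 h4]; apply/val_inj/eqP; rewrite eqEsubv /=.
by rewrite h2 // h4.
Qed.

(** For radii below 1 the span of the short elements of an order is 0. It generates the rationals,
    just as the line of 1 does, because every subfield contains 1. *)
Lemma generates0 F : generates 0%VS F <-> generates 1%VS F.
Proof.
by split=> -[h1 h2]; (split=> [|E hE]; first by rewrite ?sub0v ?sub1v);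
  apply: h2; rewrite ?sub0v ?sub1v.
Qed.
End Spans.

(** * Successive minima *)

Section SuccessiveMinima.
Variables (R : realType) (K : fieldExtType rat).
Implicit Types L : set K.

Definition qspan_le L (r : R) : {vspace K} := qspan (bounded_part L r).

Lemma succ_minE L i :
  succ_min R L i = inf [set r | 0 < r /\ (i < \dim (qspan_le L r))%N].
Proof.
rewrite /succ_min; congr inf; apply/seteqP; split=> r /= [r0].
  by move=> [V [/is_QspanE ->]].
by move=> h; split=> //; exists (qspan_le L r); split=> //; exact: qspanP.
Qed.

Lemma qspan_le_mono L r r' : r <= r' -> (qspan_le L r <= qspan_le L r')%VS.
Proof.
move=> rr'; apply/qspan_sub => x [Lx xr]; apply: mem_qspan; split=> //.
exact: le_trans rr'.
Qed.

Lemma mem_qspan_le L r x : L x -> nf_norm R x <= r -> x \in qspan_le L r.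
Proof. by move=> Lx xr; exact: mem_qspan. Qed.

Lemma succ_min_le L i r :
  0 < r -> (i < \dim (qspan_le L r))%N -> succ_min R L i <= r.
Proof.
move=> r0 h; rewrite succ_minE; apply: ge_inf => //.
by exists 0 => x [/ltW].
Qed.

Section Full.
Variables (n : nat) (L : set K) (e : n.-tuple K).
Hypothesis he : zbasis L e.

Lemma qspan_le_full : exists2 r, 0 < r & qspan_le L r = fullv.
Proof.
have N0 x : 0 <= nf_norm R x by exact: sqrtr_ge0.
pose r := 1 + \sum_i nf_norm R (tnth e i).
exists r; first by rewrite ltr_pwDl // sumr_ge0.
apply/eqP; rewrite eqEsubv subvf -(span_basis he.1) /=.
apply/span_subvP => x /tnthP[i ->]; apply: mem_qspan_le; first exact: zbasis_mem.
by rewrite /r (bigD1 i) //= addrCA lerDl addr_ge0 ?sumr_ge0.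
Qed.

(** Full rank and the bound on [i] make the set of radii nonempty; on the empty set [inf] would be a
    default value. *)
Lemma succ_min_ge i b : (i < \dim {:K})%N ->
  (forall r, 0 < r -> (i < \dim (qspan_le L r))%N -> b <= r) ->
  b <= succ_min R L i.
Proof.
move=> hi hb; rewrite succ_minE; apply: lb_le_inf => [|r [r0 hr]]; last exact: hb.
by have [r r0 hr] := qspan_le_full; exists r; split=> //; rewrite hr.
Qed.

(** The strict inequality allows an argument with the infimum alone, without showing that it is
    attained. *)
Lemma dim_qspan_le i r : (i < \dim {:K})%N -> succ_min R L i < r ->
  (i < \dim (qspan_le L r))%N.
Proof.
move=> hi; rewrite ltNge => /negP h; apply: contra_notT h; rewrite -leqNgt => h.
apply: succ_min_ge => // r' r'0 hr'; rewrite leNgt; apply/negP => /ltW.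
move=> /(qspan_le_mono L)/dimvS; lia.
Qed.

Lemma succ_min_mono i j : (i <= j)%N -> (j < \dim {:K})%N ->
  succ_min R L i <= succ_min R L j.
Proof.
move=> ij hj; apply: succ_min_ge => // r r0 hr; apply: succ_min_le => //.
exact: leq_ltn_trans hr.
Qed.
End Full.
End SuccessiveMinima.

Lemma degree_embedding (R : realType) (K : fieldExtType rat) :
  exists s : 'I_(\dim {:K}) -> {rmorphism K -> R[i]}, enumerates s.
Proof. exact: enumerates_exists. Qed.

Section OrderMinima.
Variables (R : realType) (O : nf_order).
Notation K := (order_field O).

Lemma order_norm1 : nf_norm R (1 : K) = 1.
Proof. by have [s hs] := degree_embedding R K; exact: (nf_norm1 hs). Qed.

Lemma order_norm_gt (x : K) : order_set O x -> x != 0 -> 1 <= nf_norm R x.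
Proof.
move=> Ox x0; have [s hs] := degree_embedding R K.
have [e he] := order_zbasis (erefl (\dim {:K})).
exact: (order_norm_ge1 hs erefl he (@order_mul O)).
Qed.

Lemma order1 : order_set O 1. Proof. by have [] := order_setP O. Qed.

(** In an order 1 is a shortest nonzero element, so it belongs to the span as soon as the span is
    nonzero. *)
Lemma qspan_le_dichotomy (r : R) :
  qspan_le (order_set O) r = 0%VS \/ 1 <= r /\ 1 \in qspan_le (order_set O) r.
Proof.
have [h|/existsNP[x]] := pselect (forall x : K, bounded_part (order_set O) r x -> x = 0).
  left; apply/eqP; rewrite -subv0; apply/qspan_sub => x /h ->; exact: mem0v.
move=> /not_implyP[[Ox xr] /eqP x0]; right.
have r1 : 1 <= r by apply: le_trans xr; exact: order_norm_gt.
by split=> //; apply: mem_qspan_le; [exact: order1|rewrite order_norm1].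
Qed.

Lemma lambda_ge1 i : (i < \dim {:K})%N -> 1 <= lambda R O i.
Proof.
have [e he] := order_zbasis (erefl (\dim {:K})).
move=> hi; apply: (succ_min_ge he) => // r _.
by case: (qspan_le_dichotomy r) => [->|[]//]; rewrite dimv0.
Qed.
End OrderMinima.

(** * Invariance under field isomorphisms *)

Section FieldIso.
Variables (R : realType) (K K' : fieldExtType rat).
Variables (f : {rmorphism K -> K'}).
Hypothesis bij_f : bijective f.

Lemma field_iso_linear : exists h : 'AHom(K, K'), forall x, h x = f x.
Proof.
pose g : {lrmorphism K -> K'} :=
  HB.pack (f : K -> K') f (GRing.isScalable.Build _ _ _ _ _ (fmorph_numZ f)).
by exists (linfun_ahom g) => x; exact: (lfunE g).
Qed.

(** Precomposition with [f] is a bijection between the embeddings of the two fields. *)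
Lemma nf_norm_iso x : nf_norm R (f x) = nf_norm R x.
Proof.
have [g fK gK] := bij_f.
have [h hf] := field_iso_linear.
have dimKK : \dim {:K} = \dim {:K'}.
  have -> : {:K'}%VS = (h @: {:K})%VS.
    apply/vspaceP => y; rewrite memvf; apply/esym/memv_imgP.
    by exists (g y); rewrite ?memvf // hf gK.
  rewrite limg_dim_eq //; apply/eqP; rewrite capfv -subv0.
  apply/subvP => z; rewrite memv_ker hf fmorph_eq0 => /eqP ->; exact: mem0v.
rewrite /nf_norm -dimKK; congr (Num.sqrt (_ * _)).
have hb : set_bij (@embeddings K' R) (@embeddings K R) (fun t z => t (f z)).
  split=> [_ [t _ <-]|t t' _ _ e|_ [t _ <-]].
  - by exists (t \o f).
  - by apply/funext => y; move/(congr1 (@^~ (g y))): e; rewrite gK.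
  - have gadd : zmod_morphism g by exact: can2_zmod_morphism fK gK.
    have gmul : monoid_morphism g by exact: can2_monoid_morphism fK gK.
    pose G : {rmorphism K' -> K} := HB.pack g
      (GRing.isZmodMorphism.Build _ _ g gadd) (GRing.isMonoidMorphism.Build _ _ g gmul).
    by exists (t \o G); [exists (t \o G)|apply/funext => y /=; rewrite fK].
by rewrite [RHS](reindex_fsbig _ _ _ _ hb).
Qed.

Variables (L : set K) (L' : set K').
Hypothesis LL' : forall x, L x <-> L' (f x).

Lemma bounded_part_iso (r : R) x : bounded_part L r x <-> bounded_part L' r (f x).
Proof. by rewrite /bounded_part /= nf_norm_iso LL'. Qed.

Lemma dim_qspan_le_iso (r : R) : \dim (qspan_le L' r) = \dim (qspan_le L r).
Proof.
have [g fK gK] := bij_f; have [h hf] := field_iso_linear.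
suff -> : qspan_le L' r = (h @: qspan_le L r)%VS.
  rewrite limg_dim_eq //; apply/eqP; rewrite -subv0; apply/subvP => z.
  by rewrite memv_cap memv_ker hf fmorph_eq0 => /andP[_ /eqP ->]; exact: mem0v.
apply/eqP; rewrite eqEsubv; apply/andP; split.
  apply/qspan_sub => y; rewrite -[y]gK => /bounded_part_iso hy.
  by rewrite -hf memv_img // mem_qspan.
apply/subvP => _ /memv_imgP[x hx ->].
suff : (qspan_le L r <= h @^-1: qspan_le L' r)%VS.
  by move/subvP => /(_ x hx); rewrite -memv_preim.
apply/qspan_sub => z /bounded_part_iso hz; rewrite -memv_preim hf.
exact: mem_qspan.
Qed.

Lemma succ_min_iso i : succ_min R L' i = succ_min R L i.
Proof.
rewrite !succ_minE; congr inf; apply/seteqP; split=> r /=;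
by rewrite dim_qspan_le_iso.
Qed.

Lemma has_tower_type_iso T : has_tower_type R L T -> has_tower_type R L' T.
Proof.
have [g fK gK] := bij_f; have [h hf] := field_iso_linear.
have hmem (F : {vspace K}) y : (y \in (h @: F)%VS) = (g y \in F).
  apply/memv_imgP/idP => [[x xF ->]|yF]; first by rewrite hf fK.
  by exists (g y); rewrite ?hf ?gK.
(* The preimage of a subfield is a subfield, so every subfield of [K'] is an image; this transports
   the minimality clause of [is_Qadjoin] and the list of fields. *)
have hpre (F' : {subfield K'}) : exists F : {subfield K}, F' = (h @: F)%AS.
  have hF : has_algid (h @^-1: F')%VS /\ (h @^-1: F' * h @^-1: F' <= h @^-1: F')%VS.
    split; first by apply: has_algid1; rewrite -memv_preim rmorph1 mem1v.
    apply/prodvP => x y; rewrite -!memv_preim rmorphM; exact: rpredM.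
  have hF' : is_aspace (h @^-1: F')%VS by rewrite /is_aspace; apply/andP.
  exists (ASpace hF'); apply/val_inj/vspaceP => y /=.
  by rewrite hmem -memv_preim hf gK.
have hS (F E : {vspace K}) : (h @: F <= h @: E)%VS = (F <= E)%VS.
  apply/idP/idP => [/subvP hFE|]; last exact: limgS.
  by apply/subvP => x xF; have := hFE (f x); rewrite !hmem fK; exact.
have hdim (F : {vspace K}) : \dim (h @: F) = \dim F.
  rewrite limg_dim_eq //; apply/eqP; rewrite -subv0; apply/subvP => z.
  by rewrite memv_cap memv_ker hf fmorph_eq0 => /andP[_ /eqP ->]; exact: mem0v.
have hadj (F : {subfield K}) (r : R) :
    is_Qadjoin (bounded_part L' r) (h @: F)%AS <-> is_Qadjoin (bounded_part L r) F.
  split=> -[h1 h2]; split=> [x|E hE].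
  - by move=> /bounded_part_iso/h1; rewrite hmem fK.
  - rewrite -hS; apply: (h2 (h @: E)%AS) => y; rewrite -[y]gK => /bounded_part_iso/hE.
    by rewrite hmem fK.
  - by rewrite -[x]gK => /bounded_part_iso/h1; rewrite hmem fK.
  - have [E' eE] := hpre E; rewrite eE in hE *; rewrite /= hS; apply: h2 => x.
    by move=> /bounded_part_iso/hE; rewrite hmem fK.
move=> [Ks [K0 Kt Kstep Kadj]]; exists (fun s => (h @: Ks s)%AS); split.
- by rewrite K0; apply/val_inj; rewrite /= aimg1.
- rewrite Kt; apply/val_inj/vspaceP => y; by rewrite /= hmem !memvf.
- move=> m /Kstep[h1 h2 h3]; split; first by rewrite hS.
    move=> /(congr1 val) /= e; apply: h2; apply/val_inj/eqP => /=.
    by rewrite eqEsubv -!hS /= e subvv.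
  by rewrite /= !hdim.
- move=> F'; have [F ->] := hpre F'; split=> [[m ms /(congr1 val) /= e]|[r [r0 /hadj hr]]].
    have -> : F = Ks m.
      by apply/val_inj/eqP => /=; rewrite eqEsubv -!hS /= e subvv.
    have [r [r0 hr]] := (Kadj (Ks m)).1 (ex_intro2 _ _ m ms erefl).
    by exists r; split=> //; apply/hadj.
  have [m ms ->] := (Kadj F).2 (ex_intro _ r (conj r0 hr)).
  by exists m.
Qed.
End FieldIso.

(** * Finiteness of orders of bounded discriminant *)

(** One order is chosen for each code that occurs in [S], and a fixed [O0] fills the remaining
    codes. For empty [S] the empty list serves. *)
Lemma finitely_many_of_code (X : finType) (code : nf_order -> X -> Prop)
    (S : nf_order -> Prop) :
  (forall O, S O -> exists x, code O x) ->
  (forall O O' x, S O -> code O x -> code O' x -> order_iso O O') ->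
  finitely_many_classes S.
Proof.
move=> hex hiso; have [[O0 SO0]|hS] := pselect (exists O, S O); last first.
  have f (l : 'I_0) : nf_order by case: l.
  by exists 0%N, f => O SO; case: hS; exists O.
have /choice[f hf] : forall x, exists O,
    (exists2 O', S O' & code O' x) -> S O /\ code O x.
  move=> x; have [[O SO hO]|h] := pselect (exists2 O', S O' & code O' x).
    by exists O.
  by exists O0.
exists #|X|, (fun l => f (enum_val l)) => O SO; have [x hx] := hex O SO.
exists (enum_rank x); rewrite enum_rankK.
have [Sf cf] := hf x (ex_intro2 _ _ O SO hx).
exact: hiso Sf cf hx.
Qed.

Section ChangeOfBasis.
Variables (K : fieldExtType rat) (n : nat) (L : set K) (e : n.-tuple K).
Hypothesis he : zbasis L e.

Lemma zbasis_unimodular (U : 'M[int]_n) : U \in unitmx ->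
  zbasis L [tuple \sum_j tnth e j *~ U i j | i < n].
Proof.
move=> hU; set e' := [tuple _ | i < n].
have comb (c : 'I_n -> int) : \sum_i tnth e' i *~ c i =
    \sum_j tnth e j *~ (\sum_i c i * U i j).
  under eq_bigr do rewrite tnth_mktuple mulrz_suml.
  rewrite exchange_big; apply: eq_bigr => j _ /=.
  by rewrite mulrz_sumr; apply: eq_bigr => i _; rewrite -mulrzA mulrC.
have uncomb (c : 'I_n -> int) : exists d : 'I_n -> int,
    \sum_i tnth e i *~ c i = \sum_i tnth e' i *~ d i.
  exists (fun i => (\row_k c k *m invmx U) 0 i); rewrite comb.
  apply: eq_bigr => j _; congr (_ *~ _).
  have <- : (\row_k c k *m invmx U *m U) 0 j = c j by rewrite mulmxKV // mxE.
  by rewrite mxE.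
have hL x : L x <-> exists c : 'I_n -> int, x = \sum_i tnth e' i *~ c i.
  rewrite he.2; split=> -[c ->]; first exact: uncomb.
  by rewrite comb; eexists.
split=> //; rewrite basisEdim size_tuple (size_basis he.1) leqnn andbT.
rewrite -(span_basis he.1); apply/span_subvP => x /tnthP[i ->].
have [c ->] := (hL _).1 (zbasis_mem i he); apply: rpred_sum => j _.
by rewrite -scaler_int rpredZ // memv_span // mem_tnth.
Qed.
End ChangeOfBasis.

Section Hermite.
Variables (R : realType) (n : nat).

(** Reduction applies to the Gram matrix of [nf_form]: its diagonal values are at least 1 in every
    integral basis of an order, and its determinant is at most the discriminant. The bound [1 + |B|]
    on the norm avoids a square root, its square being larger than [B]. *)
Lemma reduced_zbasis (D : R) : exists2 B : R, 0 <= B & forall O : nf_order,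
  \dim {:order_field O} = n -> Delta R O <= D ->
  exists2 e : n.-tuple (order_field O), zbasis (order_set O) e &
    forall i, nf_norm R (tnth e i) <= B.
Proof.
case: n => [|n']; first by exists 0 => // O h; have := adim_gt0 {:order_field O}; rewrite h.
have [B hB] := @basis_reduction R n' 1 `|D| ltr01 (normr_ge0 D).
exists (1 + `|B|) => [|O dimK hD]; first by rewrite addr_ge0.
have [e he] := order_zbasis dimK; have [s hs] := enumerates_exists R dimK.
pose G := \matrix_(i, j) nf_form s (tnth e i) (tnth e j).
have hG U : gram_change G U =
    \matrix_(i, j) nf_form s (\sum_k tnth e k *~ U i k) (\sum_k tnth e k *~ U j k).
  rewrite /G (@gram_change_form _ _ _ (nf_form s) (tnth e) (fun i => \sum_k tnth e k *~ U i k) U) //.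
  - exact: nf_form_zmod.
  - by move=> x y z; rewrite !(nf_formC _ x) nf_form_zmod.
have diagG U i : gram_change G U i i = nf_norm R (\sum_k tnth e k *~ U i k) ^+ 2.
  by rewrite hG mxE (nf_form_sqr hs dimK).
have [| | |U hU hUB] := hB G.
- by apply/matrixP => i j; rewrite !mxE nf_formC.
- move=> U i /(zbasis_unimodular he) he'; rewrite diagG.
  have eU : \sum_k tnth e k *~ U i k = tnth [tuple \sum_j tnth e j *~ U i j | i < n'.+1] i.
    by rewrite tnth_mktuple.
  rewrite eU exprn_ege1 // order_norm_gt //; first exact: zbasis_mem.
  by apply: (free_not0 (basis_free he'.1)); rewrite mem_tnth.
- apply: le_trans (det_nf_form hs dimK he.1) _.
  have -> : `|ratr (disc e)| = Delta R O.
    by rewrite /Delta (abs_discE he) -ratr_norm.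
  exact: le_trans hD (ler_norm _).
exists [tuple \sum_j tnth e j *~ U i j | i < n'.+1]; first exact: zbasis_unimodular.
move=> i; rewrite tnth_mktuple leNgt; apply/negP => hlt.
have := hUB i; rewrite diagG; have := ler_norm B; nra.
Qed.

Lemma nf_trace_le (K : fieldExtType rat) (x : K) : \dim {:K} = n ->
  `|ratr (nf_trace x) : R| <= n%:R ^+ 2 * nf_norm R x.
Proof.
move=> <-; have [s hs] := degree_embedding R K.
rewrite -normc_ratr (nf_traceE x (vbasisP _)) (trace_mulmat hs _ (vbasisP _)).
apply: le_trans (normc_sum _ _) _.
rewrite expr2 -mulrA -[X in X%:R * _]card_ord mulr_natl -sumr_const.
by apply: ler_sum => m _; exact: normc_le.
Qed.

(** An ordinal below [2 * m], shifted down by [m], encodes an integer between [-m] and [m - 1]; so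
    the codes form a finite type. *)
Definition has_traces (m : nat) (O : nf_order)
    (t : {ffun 'I_n * 'I_n -> 'I_(2 * m)} * {ffun 'I_n * 'I_n * 'I_n -> 'I_(2 * m)}) : Prop :=
  exists e : n.-tuple (order_field O), [/\ zbasis (order_set O) e,
    forall i j, nf_trace (tnth e i * tnth e j) = (t.1 (i, j))%:R - m%:R &
    forall i j k, nf_trace (tnth e i * tnth e j * tnth e k) = (t.2 (i, j, k))%:R - m%:R].

(** The matrix of the traces of pairs is invertible, because the discriminant is nonzero; so the
    linear system for the structure constants has one solution. *)
Lemma order_iso_of_traces m (O O' : nf_order) t :
  \dim {:order_field O} = n ->
  has_traces O t -> has_traces (m := m) O' t -> order_iso O O'.
Proof.
move=> dimK [e [he h2 h3]] [e' [he' h2' h3']].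
pose G := \matrix_(i, j) nf_trace (tnth e i * tnth e j).
have eG : G = \matrix_(i, j) nf_trace (tnth e' i * tnth e' j).
  by apply/matrixP => i j; rewrite !mxE h2 h2'.
have hu : G \in unitmx.
  have [s hs] := enumerates_exists R dimK.
  by rewrite unitmxE unitfE; exact: (disc_neq0 hs he.1).
(* the structure constants are recovered from the traces of the products *)
have recover (K : fieldExtType rat) (b : n.-tuple K) i j : basis_of fullv b ->
    (\row_k coord b k (tnth b i * tnth b j)) *m
      (\matrix_(k, l) nf_trace (tnth b k * tnth b l)) =
    \row_k nf_trace (tnth b i * tnth b j * tnth b k).
  move=> hb; apply/rowP => l; rewrite !mxE.
  pose tr : {additive K -> rat} :=
    HB.pack (@nf_trace K) (GRing.isZmodMorphism.Build _ _ _ (@nf_trace_zmod K)).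
  have trZ a (x : K) : nf_trace (a *: x) = a * nf_trace x.
    rewrite !(nf_traceE _ hb) -mxtraceZ; congr (\tr _).
    by apply/matrixP => p q; rewrite !mxE -scalerAr linearZ.
  rewrite [in RHS](coord_sum hb (tnth b i * tnth b j)) mulr_suml.
  rewrite -[RHS]/(tr _) raddf_sum; apply: eq_bigr => k _.
  by rewrite !mxE -scalerAl /= trZ.
apply: (order_iso_of_basis he he') => i j k.
have h : \row_k coord e k (tnth e i * tnth e j) = \row_k coord e' k (tnth e' i * tnth e' j).
  apply: (can_inj (mulmxK hu)). rewrite {2}eG (recover _ _ _ _ he.1) (recover _ _ _ _ he'.1).
  by apply/rowP => l; rewrite !mxE h3 h3'.
by have /rowP/(_ k) := h; rewrite !mxE.
Qed.

Lemma hermite_finiteness (D : R) (S : nf_order -> Prop) :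
  (forall O, S O -> \dim {:order_field O} = n /\ Delta R O <= D) ->
  finitely_many_classes S.
Proof.
move=> hS; have [B B0 hB] := reduced_zbasis D.
have nn : 0 <= n%:R :> R by exact: ler0n.
(* Bounds for the traces of products of two and three elements of norm at most [B]: each product
   costs a factor [n ^ 2] by [nf_normM], and the trace one more by [nf_trace_le]. *)
pose b2 := n%:R ^+ 2 * (n%:R ^+ 2 * (B * B)).
pose b3 := n%:R ^+ 2 * (n%:R ^+ 2 * (n%:R ^+ 2 * (B * B) * B)).
have b20 : 0 <= b2 by rewrite !mulr_ge0 ?exprn_ge0.
have b30 : 0 <= b3 by rewrite !mulr_ge0 ?exprn_ge0.
pose m := (Num.truncn (b2 + b3)).+1.
have hm : b2 + b3 < m%:R by exact: truncnS_gt.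
have enc (a : int) : `|a%:~R : R| < m%:R ->
    exists p : 'I_(2 * m), a%:~R = p%:R - m%:R :> rat.
  move=> ha; have ha' : `|a| < m%:Z by rewrite -(ltr_int R) intr_norm.
  have lt : (absz (a + m%:Z)%R < 2 * m)%N by lia.
  exists (Ordinal lt) => /=; have e : Posz (absz (a + m%:Z)%R) = a + m%:Z by lia.
  have -> : (absz (a + m%:Z)%R)%:R = (a + m%:Z)%:~R :> rat by rewrite -[in RHS]e.
  by rewrite intrD addrK.
apply: (@finitely_many_of_code _ (@has_traces m)) => [O SO|O O' t SO]; last first.
  by apply: order_iso_of_traces; have [] := hS O SO.
have [dimK hD] := hS O SO; have [e he heB] := hB O dimK hD.
have [s hs] := enumerates_exists R dimK.
have Oe i : order_set O (tnth e i) by exact: zbasis_mem.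
have N0 (x : order_field O) : 0 <= nf_norm R x by exact: sqrtr_ge0.
have e2 i j : nf_norm R (tnth e i * tnth e j) <= n%:R ^+ 2 * (B * B).
  apply: le_trans (nf_normM hs dimK _ _) _.
  by rewrite ler_wpM2l ?exprn_ge0 // ler_pM.
have e3 i j k : nf_norm R (tnth e i * tnth e j * tnth e k) <=
    n%:R ^+ 2 * (n%:R ^+ 2 * (B * B) * B).
  apply: le_trans (nf_normM hs dimK _ _) _.
  by rewrite ler_wpM2l ?exprn_ge0 // ler_pM.
have encT x : order_set O x -> n%:R ^+ 2 * nf_norm R x <= b2 + b3 ->
    exists p : 'I_(2 * m), nf_trace x = p%:R - m%:R.
  move=> Ox hx; have [a ha] := nf_trace_int he (@order_mul O) Ox.
  rewrite ha; apply: enc; rewrite -(ratr_int R) -ha.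
  exact: le_lt_trans (le_trans (nf_trace_le x dimK) hx) hm.
have /choice[t2 ht2] : forall ij : 'I_n * 'I_n, exists p : 'I_(2 * m),
    nf_trace (tnth e ij.1 * tnth e ij.2) = p%:R - m%:R.
  move=> [i j]; apply: encT; first exact: order_mul.
  by apply: ler_wpDr => //; rewrite ler_wpM2l ?exprn_ge0.
have /choice[t3 ht3] : forall ijk : 'I_n * 'I_n * 'I_n, exists p : 'I_(2 * m),
    nf_trace (tnth e ijk.1.1 * tnth e ijk.1.2 * tnth e ijk.2) = p%:R - m%:R.
  move=> [[i j] k]; apply: encT; first by apply: order_mul => //; exact: order_mul.
  by apply: ler_wpDl => //; rewrite ler_wpM2l ?exprn_ge0.
exists (finfun t2, finfun t3), e; split=> // [i j|i j k]; rewrite ffunE.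
  exact: (ht2 (i, j)).
exact: (ht3 (i, j, k)).
Qed.
End Hermite.

(** * Adapted bases *)

Section PrimitiveElement.
Variable K : fieldExtType rat.

(** In characteristic 0 the primitive element can be an integral combination of [x] and [y]. It then
    stays in every subspace containing both. *)
Lemma PET_nat (F : {subfield K}) (x y : K) :
  exists m : nat, x \in <<F; y *+ m - x>>%VS /\ y \in <<F; y *+ m - x>>%VS.
Proof.
have minP u : exists2 p : {poly subvs_of F}, p != 0 & root (map_poly vsval p) u.
  have /polyOver_subvs[p Dp] : minPoly F u \is a polyOver F := minPolyOver F u.
  exists p; last by rewrite -Dp root_minPoly.
  have : minPoly F u != 0 by rewrite monic_neq0 ?monic_minPoly.
  by rewrite Dp map_poly_eq0.
have [p p0 px] := minP x; have [q q0 qy] := minP y.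
have char0 : [pchar (subvs_of F)] =i pred0 by move=> k; rewrite pchar_lalg pchar_num.
have [m [[r1 h1] [r2 h2]]] := pchar0_PET p0 px q0 qy char0.
exists m; move: (y *+ m - x) h1 h2 => z h1 h2.
have Kz (r : {poly subvs_of F}) : (map_poly vsval r).[z] \in <<F; z>>%VS.
  rewrite rpred_horner ?memv_adjoin ?(polyOverSv (subv_adjoin F z)) //.
  by apply/polyOver_subvs; exists r.
by rewrite -h1 -h2; split; exact: Kz.
Qed.

Lemma PET_seq (F : {subfield K}) (V : {vspace K}) (s : seq K) :
  {subset s <= V} -> exists2 z, z \in V & {subset s <= <<F; z>>%VS}.
Proof.
elim: s => [|x s IH] hs; first by exists 0; rewrite ?mem0v.
have [|y yV hy] := IH; first by move=> u us; apply: hs; rewrite inE us orbT.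
have [m [hx hym]] := PET_nat F x y; exists (y *+ m - x).
  by rewrite rpredB ?rpredMn //; apply: hs; exact: mem_head.
move=> u; rewrite inE => /orP[/eqP -> //|/hy].
by apply: (subvP _ u); apply/FadjoinP; rewrite subv_adjoin.
Qed.

(** Let [E] be the field generated by [W], and take [z] in [V] primitive over [E] for the field
    generated by [V]. If [z] happens to lie in [W], then [E] is already all of [F], and any vector
    of [V] outside [W] will do. *)
Lemma generating_extension (W V : {vspace K}) (F : {subfield K}) :
  (W <= V)%VS -> ~~ (V <= W)%VS -> generates V F ->
  exists z, [/\ z \in V, z \notin W & generates (W + <[z]>) F].
Proof.
move=> WV nVW [VF hF]; have [E [WE hE]] := generates_exists W.
have [z zV hz] := @PET_seq E V (vbasis V) (fun x => @vbasis_mem _ _ x V).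
have sub_F u : u \in V -> (W + <[u]> <= F)%VS.
  by move=> uV; rewrite subv_add (subv_trans WV VF) -memvE (subvP VF).
have Ez (E' : {subfield K}) : (W <= E')%VS -> z \in E' -> (F <= E')%VS.
  move=> WE' zE'; apply: hF; rewrite -(span_basis (vbasisP V)).
  apply/span_subvP => u /hz; apply: (subvP _ u); apply/FadjoinP; split=> //.
  exact: hE.
have [zW|zW] := boolP (z \in W); last first.
  exists z; split=> //; split; first exact: sub_F.
  by move=> E'; rewrite subv_add -memvE => /andP[h1 h2]; exact: Ez.
have /subvPn[u uV uW] := nVW; exists u; split=> //; split; first exact: sub_F.
move=> E'; rewrite subv_add => /andP[h1 _]; apply: Ez => //; exact: (subvP h1).
Qed.
End PrimitiveElement.

Section Flag.
Variables (R : realType) (O : nf_order).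
Notation K := (order_field O).
Notation V := (qspan_le (order_set O)).

(* [X] is an initial segment of a flag refining the chain of the spans [V r],
   in which every member generates the same field as some [V r]. *)
Definition adapted (X : seq K) : Prop :=
  [/\ free X, nth 0 X 0 = 1,
      forall r : R, (exists2 p, (p <= size X)%N & V r = <<take p X>>%VS) \/
                    (<<X>> <= V r)%VS &
      forall l, (l < size X)%N -> exists r : R, exists F : {subfield K},
        [/\ 0 < r, generates <<take l.+1 X>>%VS F & generates (V r) F]].

(** The new vector is taken from a span [V r] of least dimension among those not contained in the
    span of [X]. By minimality every other such span contains [V r], so the longer segment is still
    comparable with all spans. *)
Lemma adapted_extend X : adapted X -> (0 < size X < \dim {:K})%N ->
  exists z, adapted (rcons X z).
Proof.
move=> [freeX X0 hV hgen] /andP[sz0 sz].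
have dimX : \dim <<X>>%VS = size X by apply/eqP.
have [e he] := order_zbasis (erefl (\dim {:K})).
pose P d := `[< exists r : R, [/\ 0 < r, \dim (V r) = d & ~~ (V r <= <<X>>)%VS] >].
have exP : exists d, P d.
  have [r r0 hr] := qspan_le_full R he; exists (\dim (V r)); apply/asboolP.
  exists r; split=> //; rewrite hr; apply/negP => /dimvS; rewrite dimX; lia.
case: (ex_minnP exP) => d /asboolP[r [r0 dr nr]] hmin.
have XV : (<<X>> <= V r)%VS.
  case: (hV r) => // -[p _ e']; case/negP: nr; rewrite e'.
  by apply: sub_span => x; exact: mem_take.
have [F hF] := generates_exists (V r).
have [z [zV zX hz]] := generating_extension XV nr hF.
exists z; have spanr : (<<rcons X z>> = <<X>> + <[z]>)%VS.
  by rewrite -cats1 span_cat span_seq1.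
split.
- have : perm_eq (z :: X) (rcons X z) by rewrite perm_sym perm_rcons.
  by move=> /perm_free <-; rewrite free_cons zX.
- by rewrite nth_rcons sz0.
- move=> r'; rewrite size_rcons.
  have take_le p : (p <= size X)%N -> take p (rcons X z) = take p X.
    by move=> h; rewrite -cats1 takel_cat.
  have [h|h] := boolP (V r' <= <<X>>)%VS.
    left; case: (hV r') => [[p hp e']|h'].
      by exists p; rewrite ?take_le // leqW.
    exists (size X); rewrite // take_le // take_size.
    by apply/eqP; rewrite eqEsubv h h'.
  right; rewrite spanr; apply: subv_trans (_ : V r <= V r')%VS.
    by rewrite subv_add XV -memvE.
  have r'0 : 0 < r'.
    rewrite ltNge; apply: contra h => r'0; case: (qspan_le_dichotomy O r') => [->|[h _]].
      exact: sub0v.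
    by have := le_trans h r'0; rewrite ler10.
  have [rr'|r'r] := leP r r'; first exact: qspan_le_mono.
  have := qspan_le_mono (order_set O) (ltW r'r) => hle.
  suff /eqP -> : V r' == V r by exact: subvv.
  rewrite eqEdim hle dr; apply: hmin; apply/asboolP; by exists r'.
move=> l; rewrite size_rcons ltnS leq_eqVlt => /orP[/eqP ->|hl].
  exists r, F; split=> //; rewrite take_oversize ?size_rcons //.
  by rewrite spanr.
by rewrite -cats1 takel_cat //; exact: hgen.
Qed.

Lemma adapted_basis : exists X : (\dim {:K}).-tuple K,
  basis_of {:K} X /\ adapted X.
Proof.
have h m : (0 < m <= \dim {:K})%N -> exists2 X : seq K, size X = m & adapted X.
  elim: m => // m IH; have [->|m0] := posnP m; last first.
    move=> hm; have [|X szX aX] := IH; first lia.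
    have [|z az] := adapted_extend aX; first by rewrite szX; lia.
    by exists (rcons X z); rewrite ?size_rcons ?szX.
  move=> _; exists [:: 1] => //; split=> //.
  - by rewrite free_cons nil_free span_nil memv0 oner_eq0.
  - move=> r; case: (qspan_le_dichotomy O r) => [->|[_ h]].
      by left; exists 0%N; rewrite //= span_nil.
    by right; rewrite span_seq1 -memvE.
  (* The radius 1/2 lies below the norm of every nonzero element of the order. Its span is 0, which
     generates the same field as the line of 1. *)
  - case=> [|l] // _; exists 2^-1; have [F hF] := generates_exists (1%VS : {vspace K}).
    exists F; split; [lra | by rewrite /= span_seq1|].
    case: (qspan_le_dichotomy O (2^-1 : R)) => [->|[h _]]; first exact/generates0.
    lra.
have [|X szX aX] := h (\dim {:K}); first by rewrite adim_gt0 leqnn.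
exists (Tuple (introT eqP szX)); split=> //=.
rewrite basisEfree subvf /= szX leqnn andbT.
by case: aX.
Qed.
End Flag.

(** * Dilations of an order *)

Section Initial.
Variables (K : fieldExtType rat) (n : nat) (X : n.-tuple K).
Hypothesis hX : basis_of fullv X.

Lemma coord_take p (l : 'I_n) v : v \in <<take p X>>%VS -> (p <= l)%N -> coord X l v = 0.
Proof.
move=> hv pl; suff : (<<take p X>> <= lker (linfun (coord X l : K -> rat^o)))%VS.
  by move/subvP => /(_ _ hv); rewrite memv_ker lfunE => /eqP.
apply/span_subvP => u hu; rewrite -(nth_index 0 hu); move: hu.
rewrite -index_mem size_take size_tuple; move: (index _ _) => i hi.
have ip : (i < p)%N by move: hi; case: ifP => // h hi; move: h; lia.
have iN : (i < n)%N by have := ltn_ord l; lia.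
rewrite nth_take // memv_ker lfunE /= -(tnth_nth 0 X (Ordinal iN)) coord_tnth //.
suff /negbTE -> : l != Ordinal iN by [].
by apply: contraTneq pl => ->; rewrite -ltnNge.
Qed.

Lemma mem_take_span p v : (forall l : 'I_n, (p <= l)%N -> coord X l v = 0) ->
  v \in <<take p X>>%VS.
Proof.
move=> h; rewrite (coord_sum hX v); apply: rpred_sum => l _.
have [pl|lp] := leqP p l; first by rewrite h // scale0r mem0v.
rewrite rpredZ // memv_span // (tnth_nth 0) -(nth_take 0 lp) mem_nth //.
by rewrite size_take size_tuple; case: ifP.
Qed.

Lemma dim_take p : (p <= n)%N -> \dim <<take p X>>%VS = p.
Proof.
move=> pn; have : free (take p X).
  have := basis_free hX; rewrite -{1}(cat_take_drop p X) cat_free => /and3P[]//.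
by move=> /eqP ->; rewrite size_take size_tuple; case: ltngtP pn.
Qed.

Lemma mem_take_tnth p (l : 'I_n) : (l < p)%N -> tnth X l \in <<take p X>>%VS.
Proof.
move=> lp; apply: mem_take_span => l' pl'; rewrite coord_tnth //.
by case: eqP => // e; move: lp; rewrite -e ltnNge pl'.
Qed.
End Initial.

Section Dilation.
Variables (R : realType) (K : fieldExtType rat).
Notation n := (\dim {:K}).
Variables (X : n.-tuple K) (A : nat -> nat).
Hypothesis hX : basis_of {:K} X.
Hypothesis X0 : nth 0 X 0 = 1.
Hypothesis A0 : A 0 = 0%N.
Hypothesis A_lt : forall l l', (l < l' < n)%N -> (A l < A l')%N.
Hypothesis A_mul : forall i j l : 'I_n,
  coord X l (tnth X i * tnth X j) != 0 -> (A l <= A i + A j)%N.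

(** The vector of index 0 is 1 and must stay in the lattice, so it is not multiplied by [D]. On the
    others [D] clears the denominators of the structure constants. *)
Definition dilation (D M : nat) (l : nat) : nat :=
  ((if l == 0 then 1 else D) * M ^ A l)%N.

Definition dilated_basis D M : n.-tuple K :=
  [tuple (dilation D M l)%:R *: tnth X l | l < n].

Definition dilated_lattice D M : set K :=
  [set x | exists c : 'I_n -> int, x = \sum_i tnth (dilated_basis D M) i *~ c i].

Lemma dilation_gt0 D M l : (0 < D)%N -> (0 < M)%N -> (0 < dilation D M l)%N.
Proof. by move=> D0 M0; rewrite muln_gt0 expn_gt0 M0; case: ifP; rewrite ?D0. Qed.

Section Order.
Variables D M : nat.
Hypotheses (D0 : (0 < D)%N) (M0 : (0 < M)%N).
Hypothesis hD : forall i j l : 'I_n, exists c : int,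
  D%:R * coord X l (tnth X i * tnth X j) = c%:~R.
Let w l : rat := (dilation D M l)%:R.
Let w_neq0 l : w l != 0. Proof. by rewrite pnatr_eq0 -lt0n dilation_gt0. Qed.

Lemma dilated_basisP : basis_of {:K} (dilated_basis D M).
Proof.
rewrite basisEdim size_tuple leqnn andbT -[X in (X <= _)%VS](span_basis hX).
apply/span_subvP => x /tnthP[l ->].
have -> : tnth X l = (w l)^-1 *: tnth (dilated_basis D M) l.
  by rewrite tnth_mktuple scalerA mulVf // scale1r.
by rewrite rpredZ // memv_span // mem_tnth.
Qed.

Lemma dilated_zbasis : zbasis (dilated_lattice D M) (dilated_basis D M).
Proof. by split; first exact: dilated_basisP. Qed.

Lemma coord_dilated l x : coord (dilated_basis D M) l x = (w l)^-1 * coord X l x.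
Proof.
rewrite [in RHS](coord_sum dilated_basisP x) linear_sum (bigD1 l) //= big1 => [|k kl].
  by rewrite addr0 linearZ tnth_mktuple linearZ /= coord_tnth // eqxx mulr1 mulrCA mulVf ?mulr1.
by rewrite linearZ tnth_mktuple linearZ /= coord_tnth // eq_sym (negbTE kl) !mulr0.
Qed.

Let z : 'I_n := Ordinal (adim_gt0 {:K}%AS).

Lemma dilated1 : tnth X z = 1.
Proof. by rewrite (tnth_nth 0). Qed.

(** Dilation multiplies a structure constant by [M ^ (A i + A j - A l)] and a quotient of powers of
    [D]. The exponent is nonnegative by [A_mul] whenever the constant does not vanish. *)
Lemma dilated_order : is_order (dilated_lattice D M).
Proof.
have hz := dilated_zbasis; split; last by exists (dilated_basis D M).
  apply/(zbasis_coord _ hz); exists (fun l => (l == z)%:R) => l.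
  rewrite coord_dilated -dilated1 coord_tnth //; case: eqP => [->|_]; last by rewrite mulr0.
  by rewrite /w /dilation /= A0 expn0 muln1 mulr1 invr1.
have mul_int i j l : exists c : int,
    coord (dilated_basis D M) l (tnth (dilated_basis D M) i * tnth (dilated_basis D M) j) = c%:~R.
  rewrite coord_dilated !tnth_mktuple -scalerAl -scalerAr !linearZ /=.
  set a := coord X l _.
  have [a0|a0] := eqVneq a 0; first by exists 0; rewrite a0 !mulr0.
  have hA := A_mul a0.
  have hM : (M ^ A i * M ^ A j = M ^ (A i + A j - A l) * M ^ A l)%N.
    by rewrite -!expnD subnK.
  pose d (l : nat) := if l == 0 then 1%N else D.
  have dn (l' : nat) : (d l')%:R != 0 :> rat.
    by rewrite pnatr_eq0 -lt0n /d; case: ifP.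
  (* If [i] or [j] is 0, the product is a basis vector, the constant is 1 and the factors [D]
     cancel. Otherwise two factors [D] stand against at most one in the denominator, and one is left
     to clear [a]. *)
  have [c hc] : exists c : int, (d l)%:R^-1 * ((d i)%:R * ((d j)%:R * a)) = c%:~R.
    have [ei|i0] := eqVneq (i : nat) 0%N.
      have ez : i = z by exact/val_inj.
      have ha : a = (l == j)%:R by rewrite /a ez dilated1 mul1r coord_tnth.
      have el : j = l by move: a0; rewrite ha; have [->|_] := eqVneq l j; rewrite ?eqxx.
      have di : (d i)%:R = 1 :> rat by rewrite /d ei.
      by exists 1; rewrite ha -el eqxx mulr1 di mul1r mulVf.
    have [ej|j0] := eqVneq (j : nat) 0%N.
      have ez : j = z by exact/val_inj.
      have ha : a = (l == i)%:R by rewrite /a ez dilated1 mulr1 coord_tnth.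
      have el : i = l by move: a0; rewrite ha; have [->|_] := eqVneq l i; rewrite ?eqxx.
      have dj : (d j)%:R = 1 :> rat by rewrite /d ej.
      by exists 1; rewrite ha -el eqxx mulr1 dj mulr1 mulVf.
    have [c hc] := hD i j l; rewrite /d (negbTE i0) (negbTE j0) hc.
    have Dn : D%:R != 0 :> rat by rewrite pnatr_eq0 -lt0n.
    case: ifP => _; [exists (D%:R * c) | exists c].
      by rewrite invr1 mul1r rmorphM /= rmorph_nat.
    by rewrite mulrA mulVf // mul1r.
  exists ((M ^ (A i + A j - A l))%N%:R * c).
  have Ml : (M ^ A l)%:R != 0 :> rat by rewrite pnatr_eq0 -lt0n expn_gt0 M0.
  have -> : (w l)^-1 * ((dilation D M i)%:R * ((dilation D M j)%:R * a)) =
     (M ^ A l)%:R^-1 * (M ^ A i * M ^ A j)%:R * ((d l)%:R^-1 * ((d i)%:R * ((d j)%:R * a))).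
    rewrite /w /dilation -/(d i) -/(d j) -/(d l) !natrM invfM; ring.
  by rewrite hM natrM [X in X * _]mulrC mulfK // hc rmorphM /= rmorph_nat.
move=> x y [c ->] [d ->]; rewrite mulr_suml.
have mulL i y' : (exists d : 'I_n -> int, y' = \sum_i tnth (dilated_basis D M) i *~ d i) ->
    dilated_lattice D M (tnth (dilated_basis D M) i * y').
  move=> [d' ->]; rewrite mulr_sumr; under eq_bigr do rewrite -mulrzr mulrA mulrzr.
  apply: (lattice_comb hz) => j; apply/(zbasis_coord _ hz).
  by have [c' hc'] := choice (mul_int i j); exists c'.
under eq_bigr do rewrite -mulrzr mulrAC mulrzr.
by apply: (lattice_comb hz) => i; apply: mulL; exists d.
Qed.

Lemma abs_disc_dilated : abs_disc (dilated_lattice D M) =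
  (\prod_(l < n) (if l == 0 :> nat then 1 else D))%:R ^+ 2 * `|disc X| *
  M%:R ^+ (2 * \sum_(l < n) A l).
Proof.
rewrite (abs_discE dilated_zbasis).
pose W : 'M[rat]_n := diag_mx (\row_l w l).
have -> : disc (dilated_basis D M) =
    \det (W *m (\matrix_(i, j) nf_trace (tnth X i * tnth X j)) *m W).
  congr (\det _); apply/matrixP => i j.
  rewrite mul_mx_diag mul_diag_mx !mxE !tnth_mktuple -scalerAl -scalerAr scalerA.
  rewrite !(nf_traceE _ hX) mulrAC -mxtraceZ; congr (\tr _).
  by apply/matrixP => p q; rewrite !mxE -scalerAr linearZ.
rewrite !det_mulmx -/(disc X) mulrAC -expr2 normrM mulrAC ger0_norm ?sqr_ge0 //.
congr (_ * _); rewrite mulnC exprM -exprMn det_diag; congr (_ ^+ 2).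
rewrite natr_prod expr_sum -big_split /=; apply: eq_bigr => l _.
by rewrite mxE /w /dilation natrM natrX.
Qed.
End Order.

Lemma A_le l l' : (l <= l')%N -> (l' < n)%N -> (A l <= A l')%N.
Proof.
rewrite leq_eqVlt => /orP[/eqP ->//|ll'] l'n; apply: ltnW; apply: A_lt.
by rewrite ll'.
Qed.

Variable D : nat.
Hypothesis D0 : (0 < D)%N.

Let ratr_nat (k : nat) : ratr k%:R = k%:R :> R. Proof. exact: ratr_nat. Qed.

(** The constants do not depend on [M]. For the lower bound, a nonzero coordinate of a lattice
    vector is a nonzero integer times the dilation factor, and [coord_bound] compares it with the
    norm. *)
Lemma dilated_estimates : exists c C : R, [/\ 0 < c, 0 < C &
  forall M, (0 < M)%N ->
    (forall v (l : 'I_n), dilated_lattice D M v -> coord X l v != 0 ->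
      M%:R ^+ A l <= c * nf_norm R v) /\
    (forall l, nf_norm R (tnth (dilated_basis D M) l) <= C * M%:R ^+ A l)].
Proof.
have [s hs] := degree_embedding R K; have [c c0 hc] := coord_bound hs erefl hX.
have N0 (x : K) : 0 <= nf_norm R x by exact: sqrtr_ge0.
pose C : R := 1 + D%:R * \sum_(l < n) nf_norm R (tnth X l).
exists c, C; split=> //; first by rewrite ltr_pwDl // mulr_ge0 // sumr_ge0.
move=> M M0; split=> [v l hv v0|l].
  apply: le_trans (hc v l).
  have [z hz] := (zbasis_coord v (dilated_zbasis D0 M0)).1 hv.
  have w0 : (dilation D M l)%:R != 0 :> rat by rewrite pnatr_eq0 -lt0n dilation_gt0.
  have ez : coord X l v = (dilation D M l)%:R * (z l)%:~R.
    by rewrite -hz coord_dilated // mulVKf.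
  rewrite ez rmorphM /= ratr_nat ratr_int normrM ger0_norm //.
  have z1 : 1 <= `|(z l)%:~R : R|.
    rewrite -intr_norm -[1]/(1%:~R) ler_int; move: v0; rewrite ez mulf_eq0 intr_eq0.
    rewrite negb_or => /andP[_]; move: (z l) => k; lia.
  apply: (@le_trans _ _ (dilation D M l)%:R); last by rewrite ler_peMr.
  rewrite -natrX ler_nat /dilation leq_pmull //; by case: ifP.
rewrite tnth_mktuple (nf_normZ hs erefl) ratr_nat ger0_norm // /dilation natrM natrX.
rewrite mulrAC ler_wpM2r ?exprn_ge0 //.
have hl : nf_norm R (tnth X l) <= \sum_(l < n) nf_norm R (tnth X l).
  by rewrite (bigD1 l) //= lerDl sumr_ge0.
have D1 : 1 <= D%:R :> R by rewrite ler1n.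
have := N0 (tnth X l); rewrite /C; case: ifP => _; rewrite ?mul1r; nra.
Qed.

Section Spans.
Variables (M : nat) (c C : R).
Hypotheses (M0 : (0 < M)%N) (c0 : 0 < c) (C0 : 0 < C) (hM : c * C < M%:R).
Hypothesis lower : forall v (l : 'I_n), dilated_lattice D M v -> coord X l v != 0 ->
  M%:R ^+ A l <= c * nf_norm R v.
Hypothesis upper :
  forall l, nf_norm R (tnth (dilated_basis D M) l) <= C * M%:R ^+ A l.
Notation V := (@qspan_le R K (dilated_lattice D M)).

Let M1 : 1 <= M%:R :> R. Proof. by rewrite ler1n. Qed.

Lemma take_sub_dilated l r : (l < n)%N -> C * M%:R ^+ A l <= r ->
  (<<take l.+1 X>> <= V r)%VS.
Proof.
move=> ln hr; apply/span_subvP => u hu; rewrite -(nth_index 0 hu); move: hu.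
rewrite -index_mem size_take size_tuple; move: (index _ _) => i hi.
have il : (i < l.+1)%N by move: hi; case: ifP => // h hi; lia.
have iN : (i < n)%N by lia.
rewrite nth_take // -(tnth_nth 0 X (Ordinal iN)).
have w0 : (dilation D M i)%:R != 0 :> rat by rewrite pnatr_eq0 -lt0n dilation_gt0.
rewrite -[tnth X _](scalerK w0) rpredZ //.
apply: mem_qspan_le; first by have := zbasis_mem (Ordinal iN) (dilated_zbasis D0 M0);
  rewrite tnth_mktuple.
apply: le_trans hr; have := upper (Ordinal iN); rewrite tnth_mktuple => /le_trans; apply.
by rewrite ler_pM2l // ler_weXn2l //= A_le.
Qed.

Lemma dilated_sub_take p r : (p < n)%N -> c * r < M%:R ^+ A p ->
  (V r <= <<take p X>>)%VS.
Proof.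
move=> pn hr; apply/qspan_sub => v [Lv Nv]; apply: mem_take_span => // l pl.
apply/eqP; apply: contraT => /(lower Lv) h; move: hr; rewrite ltNge => /negP; case.
apply: le_trans (_ : M%:R ^+ A l <= _); first by rewrite ler_weXn2l // A_le.
by apply: le_trans h _; rewrite ler_pM2l.
Qed.

(** Let [q.+1] be the least length of an initial segment whose span contains [V r]. Then
    [M ^ A q <= c * r]. As [c * C < M] and the exponents increase strictly, the first [q] basis
    vectors have norm at most [r], which puts [V r] between two consecutive initial spans. *)
Lemma dilated_spanE r : exists2 p, (p <= n)%N & V r = <<take p X>>%VS.
Proof.
pose P p := (p <= n)%N && (V r <= <<take p X>>)%VS.
have exP : exists p, P p.
  exists n; rewrite /P leqnn take_oversize ?size_tuple //.
  by rewrite (span_basis hX) subvf.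
case: (ex_minnP exP) => -[|q] /andP[qn sub] hmin.
  by exists 0%N => //; apply/eqP; rewrite eqEsubv sub take0 span_nil sub0v.
exists q.+1 => //.
have nq : ~~ (V r <= <<take q X>>)%VS.
  apply/negP => h; have := hmin q; rewrite /P h (ltnW qn) ltnn => /(_ isT) //.
have qr : M%:R ^+ A q <= c * r.
  by rewrite leNgt; apply: contra nq => /dilated_sub_take; apply.
have tq : (<<take q X>> <= V r)%VS.
  case: q qn sub hmin nq qr => [|q] qn sub hmin nq qr.
    by rewrite take0 span_nil sub0v.
  apply: take_sub_dilated; first exact: ltnW.
  have hA : (A q < A q.+1)%N by apply: A_lt; rewrite ltnSn.
  rewrite -(ler_pM2l c0) mulrA; apply: le_trans qr.
  apply: le_trans (_ : M%:R ^+ (A q).+1 <= _); last by rewrite ler_weXn2l.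
  by rewrite exprS ler_wpM2r ?exprn_ge0 // ltW.
apply/eqP; rewrite eqEdim sub dim_take //.
rewrite ltnNge; apply: contra nq => hdim.
suff /eqP <- : <<take q X>>%VS == V r by exact: subvv.
by rewrite eqEdim tq dim_take // ltnW.
Qed.

Lemma dilated_span_take p : (p <= n)%N ->
  exists2 r, 0 < r & V r = <<take p X>>%VS.
Proof.
case: p => [|p] pn.
  (* Nonzero vectors of the dilated lattice have norm at least [1 / c], so the radius [1 / (2c)]
     gives the span 0. *)
  have hr : c * (2 * c)^-1 < M%:R ^+ A 0.
    by rewrite A0 expr0 invfM mulrCA mulfV ?gt_eqF // mulr1; lra.
  exists (2 * c)^-1; first by rewrite invr_gt0 mulr_gt0.
  by apply/eqP; rewrite eqEsubv (dilated_sub_take (adim_gt0 _) hr) take0 span_nil sub0v.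
exists (C * M%:R ^+ A p); first by rewrite mulr_gt0 ?exprn_gt0 ?ltr0n.
apply/eqP; rewrite eqEsubv take_sub_dilated // andbT.
have [pn'|pn'] := ltnP p.+1 n; last first.
  by rewrite take_oversize ?size_tuple // (span_basis hX) subvf.
apply: dilated_sub_take => //; have hA : (A p < A p.+1)%N by apply: A_lt; rewrite ltnSn.
apply: lt_le_trans (_ : M%:R ^+ (A p).+1 <= _); last by rewrite ler_weXn2l.
by rewrite mulrA exprS ltr_pM2r // exprn_gt0 // ltr0n.
Qed.

Lemma succ_min_dilated l : (l < n)%N ->
  M%:R ^+ A l <= c * succ_min R (dilated_lattice D M) l /\
  succ_min R (dilated_lattice D M) l <= C * M%:R ^+ A l.
Proof.
move=> ln; split; last first.
  apply: succ_min_le; first by rewrite mulr_gt0 ?exprn_gt0 ?ltr0n.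
  by have /dimvS := take_sub_dilated ln (lexx _); rewrite dim_take.
rewrite -ler_pdivrMl //; apply: (succ_min_ge (dilated_zbasis D0 M0)) => // r r0 hr.
rewrite ler_pdivrMl // leNgt; apply/negP => /(dilated_sub_take ln)/dimvS.
by rewrite dim_take ?(ltnW ln) // leqNgt hr.
Qed.
End Spans.
End Dilation.

(** The tower type depends only on the set of fields generated by the spans, not on the radii at
    which they occur. *)
Lemma has_tower_type_spans (R : realType) (K : fieldExtType rat) (L L' : set K) T :
  (forall F, (exists r : R, 0 < r /\ generates (qspan_le L r) F) <->
             (exists r : R, 0 < r /\ generates (qspan_le L' r) F)) ->
  has_tower_type R L T -> has_tower_type R L' T.
Proof.
move=> h [Ks [h1 h2 h3 h4]]; exists Ks; split=> // F; rewrite h4.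
have e L0 : (exists r : R, 0 < r /\ is_Qadjoin (bounded_part L0 r) F) <->
    (exists r : R, 0 < r /\ generates (qspan_le L0 r) F).
  by split=> -[r [r0 /is_QadjoinE hr]]; exists r; split=> //; apply/is_QadjoinE.
by rewrite !e.
Qed.

Lemma common_nat_denominator (I : finType) (a : I -> rat) :
  exists2 D : nat, (0 < D)%N & forall i, exists c : int, D%:R * a i = c%:~R.
Proof.
by case: (common_denominator a) => -[D|D] [D0 hD] //; exists D.
Qed.

Section Family.
Variables (R : realType) (O : nf_order).
Notation K := (order_field O).
Notation n := (\dim {:K}).
Variables (X : n.-tuple K) (A : nat -> nat).
Hypothesis hX : basis_of {:K} X.
Hypothesis aX : adapted R X.
Hypothesis A0 : A 0 = 0%N.
Hypothesis A_lt : forall l l', (l < l' < n)%N -> (A l < A l')%N.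
Hypothesis A_mul : forall i j l : 'I_n,
  coord X l (tnth X i * tnth X j) != 0 -> (A l <= A i + A j)%N.
Hypothesis n1 : (1 < n)%N.

Let S := (\sum_(l < n) A l)%N.

Lemma weight_gt0 : (0 < S)%N.
Proof.
rewrite /S (bigD1 (Ordinal n1)) //= addn_gt0.
by have := @A_lt 0 1 n1; rewrite A0 => ->.
Qed.

(** [OM M] is the dilation by [M.+1]. Logarithms of discriminant and minima are affine in [ln M.+1]
    up to a bounded error, with slopes [2 * S] and [A l]. The tower type persists because the spans
    of [OM M] are exactly the initial spans of [X], and these generate the fields of the tower of
    [O]. *)
Lemma dilated_family : exists (c0 b : R) (B0 : nat) (OM : nat -> nf_order),
  forall M, (B0 <= M)%N ->
  [/\ nf_iso K (order_field (OM M)),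
      forall T, has_tower_type R (order_set O) T -> has_tower_type R (order_set (OM M)) T,
      0 < Delta R (OM M) /\ ln (Delta R (OM M)) = c0 + (2 * S)%:R * ln M.+1%:R &
      forall l, (l < n)%N -> `|ln (lambda R (OM M) l) - (A l)%:R * ln M.+1%:R| <= b].
Proof.
have [freeX X0 hV hgen] := aX.
have [D D0 hD'] := common_nat_denominator
  (fun ijl : 'I_n * 'I_n * 'I_n => coord X ijl.2 (tnth X ijl.1.1 * tnth X ijl.1.2)).
have hD (i j l : 'I_n) : exists c : int, D%:R * coord X l (tnth X i * tnth X j) = c%:~R.
  exact: hD' (i, j, l).
have [c [C [c0 C0 hest]]] := dilated_estimates R hX A0 D0.
pose OM M := NfOrder (dilated_order hX X0 A0 A_mul D0 (ltn0Sn M) hD).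
pose P : rat := (\prod_(l < n) (if l == 0 :> nat then 1 else D))%:R ^+ 2 * `|disc X|.
have P0 : 0 < ratr P :> R.
  have [s hs] := degree_embedding R K.
  rewrite ltr0q mulr_gt0 ?normr_gt0 ?(disc_neq0 hs hX) // exprn_gt0 // ltr0n.
  by apply: prodn_gt0 => l; case: ifP.
(* From the integral part of [c * C] on, [M.+1] exceeds [c * C], as the description of the spans
   requires. *)
exists (ln (ratr P)), (`|ln c| + `|ln C|), (Num.truncn (c * C)), OM => M hM.
have hcC : c * C < M.+1%:R.
  by apply: lt_le_trans (truncnS_gt _) _; rewrite ler_nat ltnS.
have M0 : 0 < M.+1%:R :> R by rewrite ltr0n.
have [lower upper] := hest M.+1 (ltn0Sn M).
have span_take := dilated_span_take hX A0 A_lt D0 (ltn0Sn M) c0 C0 hcC lower upper.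
have spanE := dilated_spanE hX A0 A_lt D0 (ltn0Sn M) c0 C0 hcC lower upper.
split.
- by exists idfun; exists idfun.
- move=> T; apply: has_tower_type_spans => F; split=> -[r [r0 hF]].
    have [p pn e] : exists2 p, (p <= n)%N & qspan_le (order_set O) r = <<take p X>>%VS.
      case: (hV r) => [[p]|h]; first by rewrite size_tuple => ? ?; exists p.
      exists n => //; rewrite take_oversize ?size_tuple // (span_basis hX).
      by apply/eqP; rewrite eqEsubv subvf -{1}(span_basis hX).
    by have [r' r'0 e'] := span_take p pn; exists r'; rewrite /= e' -e.
  (* The empty initial segment generates the rationals, which [O] realises at the radius 1/2. *)
  have [[|p] pn e] := spanE r; rewrite /= e in hF.
    exists 2^-1; split; first by rewrite invr_gt0.
    case: (qspan_le_dichotomy O (2^-1 : R)) => [->|[h _]]; last first.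
      by move: h; rewrite leNgt invf_lt1 ?ltr1n ?ltr0n.
    by rewrite take0 span_nil in hF.
  have [|r' [F' [r'0 hF' hr']]] := hgen p; first by rewrite size_tuple.
  by exists r'; rewrite (generates_uniq hF hF').
- have eD : Delta R (OM M) = ratr P * M.+1%:R ^+ (2 * S).
    by rewrite /Delta /= abs_disc_dilated // rmorphM rmorphXn /= ratr_nat.
  rewrite eD; split; first by rewrite mulr_gt0 // exprn_gt0.
  by rewrite lnM ?posrE ?exprn_gt0 // lnXn // mulr_natl.
move=> l ln'; have [h1 h2] := succ_min_dilated hX A0 A_lt D0 (ltn0Sn M) c0 C0 hcC lower upper ln'.
have L0 : 0 < lambda R (OM M) l by apply: lt_le_trans (lambda_ge1 R (O := OM M) ln').
have MA0 : 0 < M.+1%:R ^+ A l :> R by rewrite exprn_gt0.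
move: h1 h2; rewrite -[succ_min _ _ _]/(lambda R (OM M) l).
move=> h1 h2; have lnMA : ln (M.+1%:R ^+ A l : R) = (A l)%:R * ln M.+1%:R.
  by rewrite lnXn // mulr_natl.
have h1' : (A l)%:R * ln M.+1%:R <= ln c + ln (lambda R (OM M) l).
  by rewrite -lnMA -lnM ?posrE // ler_ln ?posrE ?mulr_gt0.
have h2' : ln (lambda R (OM M) l) <= ln C + (A l)%:R * ln M.+1%:R.
  by rewrite -lnMA -lnM ?posrE // ler_ln ?posrE ?mulr_gt0.
have := ler_norm (ln c); have := ler_norm (ln C).
have := normr_ge0 (ln c); have := normr_ge0 (ln C).
by rewrite ler_norml => *; apply/andP; split; lra.
Qed.
End Family.

(** * Integer weights from the successive minima *)

Section Weights.
Variables (R : realType) (O : nf_order).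
Notation K := (order_field O).
Notation n := (\dim {:K}).
Notation V := (qspan_le (order_set O)).
Notation lam := (lambda R O).

(** For short lattice vectors this is [nf_normM]. It extends to the spans by linearity, one factor
    at a time. *)
Lemma qspan_le_mul (r r' : R) x y : 0 <= r -> 0 <= r' ->
  x \in V r -> y \in V r' -> x * y \in V (n%:R ^+ 2 * (r * r')).
Proof.
move=> r0 r'0 hx hy; have [s hs] := degree_embedding R K.
have step u : bounded_part (order_set O) r u -> u * y \in V (n%:R ^+ 2 * (r * r')).
  move=> [Ou ur].
  suff /subvP/(_ y hy) : (V r' <= amull u @^-1: V (n%:R ^+ 2 * (r * r')))%VS.
    by rewrite -memv_preim lfunE.
  apply/qspan_sub => v [Ov vr]; rewrite -memv_preim lfunE /=.
  apply: mem_qspan_le; first exact: order_mul.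
  apply: le_trans (nf_normM hs erefl _ _) _.
  by rewrite ler_wpM2l ?exprn_ge0 // ler_pM // sqrtr_ge0.
suff /subvP/(_ x hx) : (V r <= amulr y @^-1: V (n%:R ^+ 2 * (r * r')))%VS.
  by rewrite -memv_preim lfunE.
by apply/qspan_sub => v hv; rewrite -memv_preim lfunE /=; exact: step.
Qed.

Variable X : n.-tuple K.
Hypothesis hX : basis_of {:K} X.
Hypothesis aX : adapted R X.

Lemma adapted_mem (l : 'I_n) (r : R) : lam l < r -> tnth X l \in V r.
Proof.
have [e he] := order_zbasis (erefl n); have [_ _ hV _] := aX.
move=> lr; have := dim_qspan_le he (ltn_ord l) lr.
case: (hV r) => [[p]|h _]; last by rewrite (subvP h) // memv_span // mem_tnth.
rewrite size_tuple => pn ->; rewrite (dim_take hX pn); exact: mem_take_tnth.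
Qed.

Lemma adapted_coord_eq0 (l : 'I_n) (r : R) v : 0 < r -> r < lam l -> v \in V r ->
  coord X l v = 0.
Proof.
move=> r0 rl; have : (\dim (V r) <= l)%N.
  rewrite leqNgt; apply/negP => /(succ_min_le r0); rewrite leNgt.
  by rewrite -[succ_min _ _ _]/(lam l) rl.
have [_ _ hV _] := aX; case: (hV r) => [[p]|h].
  by rewrite size_tuple => pn ->; rewrite (dim_take hX pn) => pl /coord_take; exact.
move/dimvS: h; rewrite (span_basis hX) => h /(leq_trans h).
by rewrite leqNgt ltn_ord.
Qed.

(** The vectors [X_i] and [X_j] lie in the spans of radius [2 * lam i] and [2 * lam j], the factor 2
    making the comparison strict. If [lam l] were larger than the bound, the span containing their
    product would have no coordinate along [X_l]. *)
Lemma structure_constant_lambda (i j l : 'I_n) :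
  coord X l (tnth X i * tnth X j) != 0 ->
  lam l <= 4 * n%:R ^+ 2 * lam i * lam j.
Proof.
move=> h; rewrite leNgt; apply: contra h => hlt; apply/eqP.
have n0 : 0 < n%:R :> R by rewrite ltr0n adim_gt0.
have li := lambda_ge1 R (ltn_ord i); have lj := lambda_ge1 R (ltn_ord j).
apply: (@adapted_coord_eq0 l (n%:R ^+ 2 * (2 * lam i * (2 * lam j)))).
- by rewrite !mulr_gt0 ?exprn_gt0 //; lra.
- by apply: le_lt_trans hlt; rewrite le_eqVlt; apply/orP; left; apply/eqP; ring.
by apply: qspan_le_mul; try apply: adapted_mem; lra.
Qed.

Lemma weights_exist : exists A : nat -> nat,
  [/\ A 0 = 0%N, forall l l', (l < l' < n)%N -> (A l < A l')%N,
    forall i j l : 'I_n,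
      coord X l (tnth X i * tnth X j) != 0 -> (A l <= A i + A j)%N &
    forall i j k : nat, (0 < i < n)%N -> (0 < j < n)%N -> (0 < k < n)%N ->
      4 * 8 ^+ n * (4 * n%:R ^+ 2) * lam i * lam j < lam k -> (A i + A j < A k)%N].
Proof.
set C : R := 4 * n%:R ^+ 2.
have n0 : 1 <= n%:R :> R by rewrite ler1n adim_gt0.
have C1 : 1 <= C by have : 1 <= n%:R ^+ 2 :> R; [exact: exprn_ege1 | rewrite /C; lra].
have exP l : exists m, C * lam l <= 2 ^+ m.
  exists (Num.truncn (C * lam l)).+1; apply: le_trans (ltW (truncnS_gt _)) _.
  by rewrite -natrX ler_nat ltnW // ltn_expl.
(* The logarithm of [C * lam l] to base 2, rounded up. The factor [C] makes [C * lam]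
   submultiplicative along nonzero structure constants, so that [P] is subadditive there. *)
pose P l := ex_minn (exP l).
have P_ge l : C * lam l <= 2 ^+ P l by rewrite /P; case: ex_minnP.
have P_min l m : C * lam l <= 2 ^+ m -> (P l <= m)%N.
  by rewrite /P; case: ex_minnP => p _ h /h.
have P_le l : (l < n)%N -> 2 ^+ P l <= 2 * (C * lam l).
  move=> ln; have l1 := lambda_ge1 R ln.
  case e : (P l) => [|p]; first by rewrite expr0; nra.
  rewrite exprS ler_pM2l // leNgt; apply/negP => /ltW/P_min.
  by rewrite e ltnn.
have P_mono l l' : (l <= l' < n)%N -> (P l <= P l')%N.
  have [e he] := order_zbasis (erefl n).
  move=> /andP[ll' ln]; apply: P_min; apply: le_trans (P_ge l').
  by apply: ler_wpM2l; [lra | exact: (@succ_min_mono R K n _ e he l l')].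
(* The summand [l] makes the weights strictly increasing. The summand [n] occurs twice on the right
   of [A l <= A i + A j] and once on the left, which absorbs [l < n]. *)
pose A l := if l == 0%N then 0%N else (P l + n + l)%N.
exists A; split=> //.
- move=> l [|l'] // /andP[ll' ln]; rewrite /A /=; have := P_mono l l'.+1.
  rewrite (ltnW ll') ln => /(_ isT) hP; case: eqP => _; last lia.
  by have := adim_gt0 {:K}; lia.
- move=> i j l h; have := structure_constant_lambda h; rewrite -/C => hl.
  have [_ X0 _ _] := aX.
  have X1 (z : 'I_n) : z = 0%N :> nat -> tnth X z = 1.
    by move=> z0; rewrite (tnth_nth 0) z0.
  rewrite /A; have [i0|i0] := eqVneq (i : nat) 0%N.
    move: h; rewrite (X1 i i0) mul1r coord_tnth //.
    by have [-> //|_] := eqVneq l j; rewrite eqxx.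
  have [j0|j0] := eqVneq (j : nat) 0%N.
    move: h; rewrite (X1 j j0) mulr1 coord_tnth // addn0.
    by have [-> //|_] := eqVneq l i; rewrite ?(negbTE i0) ?eqxx.
  case: ifP => // _; have : (P l <= P i + P j)%N.
    apply: P_min; rewrite exprD.
    apply: le_trans (_ : (C * lam i) * (C * lam j) <= _).
      have -> : (C * lam i) * (C * lam j) = C * (C * lam i * lam j) by ring.
      by rewrite ler_pM2l // (lt_le_trans ltr01 C1).
    have li := lambda_ge1 R (ltn_ord i); have lj := lambda_ge1 R (ltn_ord j).
    by rewrite ler_pM ?P_ge // mulr_ge0 //; lra.
  have := ltn_ord l; lia.
move=> i j k /andP[i0 iN] /andP[j0 jN] /andP[k0 kN] hlt.
have li := lambda_ge1 R iN; have lj := lambda_ge1 R jN.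
(* The added summands in [A i + A j] are [2 * n + i + j], less than [4 * n], and those in [A k] are
   at least [n]. The gap of [3 * n] costs [8 ^ n], and rounding up [P i] and [P j] costs 4. *)
suff : (P i + P j + 3 * n <= P k)%N.
  by rewrite /A !gtn_eqF //; lia.
rewrite leqNgt; apply/negP => hP; move: hlt; rewrite ltNge => /negP; apply.
have C0 : 0 < C by lra.
rewrite -(ler_pM2l C0); apply: le_trans (P_ge k) _.
apply: le_trans (_ : 2 ^+ (P i + P j + 3 * n) <= _).
  by rewrite ler_weXn2l ?ler1n // ltnW.
rewrite 2!exprD exprM.
have -> : 2 ^+ 3 = 8 :> R by ring.
apply: le_trans (_ : (2 * (C * lam i)) * (2 * (C * lam j)) * 8 ^+ n <= _).
  by rewrite ler_pM2r ?exprn_gt0 // ler_pM ?exprn_ge0 ?P_le.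
have -> : forall c a b E : R, 2 * (c * a) * (2 * (c * b)) * E = c * (4 * E * c * a * b).
  by move=> *; ring.
exact: lexx.
Qed.
End Weights.

(** * The spectrum *)

Lemma order_iso_trans O1 O2 O3 : order_iso O1 O2 -> order_iso O2 O3 -> order_iso O1 O3.
Proof.
move=> [f [[fO finj fsurj] f1 fD fM]] [g [[gO ginj gsurj] g1 gD gM]].
exists (g \o f); split=> /= [|||x y Ox Oy].
- split=> [x Ox|x y Ox Oy /= e|z /gsurj[y /fsurj[x Ox <-] <-]]; last by exists x.
    by apply: gO; apply: fO.
  by apply: finj => //; apply: ginj e; apply/mem_set; apply: fO; exact/set_mem.
- by rewrite f1 g1.
- by move=> x y Ox Oy; rewrite fD // gD //; exact: fO.
- by rewrite fM // gM //; exact: fO.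
Qed.

Lemma order_iso_refl O : order_iso O O.
Proof.
by exists id; split=> //; split=> // x Ox; exists x.
Qed.

Section IsoInvariance.
Variables (R : realType) (O O' : nf_order).
Hypothesis iso : order_iso O O'.

Lemma order_iso_nf_iso : nf_iso (order_field O) (order_field O').
Proof. by have [f [bij_f _]] := order_iso_morphism iso; exists f. Qed.

Lemma order_iso_lambda i : lambda R O' i = lambda R O i.
Proof.
by have [f [bij_f hf]] := order_iso_morphism iso; exact: (succ_min_iso R bij_f hf).
Qed.

Lemma order_iso_Delta : Delta R O' = Delta R O.
Proof. by rewrite /Delta (order_iso_abs_disc iso). Qed.

Lemma order_iso_tower T :
  has_tower_type R (order_set O) T -> has_tower_type R (order_set O') T.
Proof.
by have [f [bij_f hf]] := order_iso_morphism iso; exact: (has_tower_type_iso bij_f hf).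
Qed.
End IsoInvariance.

Lemma Delta_unbounded (R : realType) n (S : nf_order -> Prop) :
  (forall O, S O -> \dim {:order_field O} = n) -> ~ finitely_many_classes S ->
  forall D : R, exists2 O, S O & D < Delta R O.
Proof.
move=> hn hS D; apply: contrapT => hD; apply: hS.
apply: (@hermite_finiteness R n D) => O SO; split; first exact: hn.
by rewrite leNgt; apply/negP => h; apply: hD; exists O.
Qed.

(** Take logarithms and divide by [ln Delta]: the constant [c] disappears in the limit because the
    discriminant is unbounded on an infinite set of classes. *)
Lemma spectrum_of_bound (R : realType) n (S : nf_order -> Prop) (i j k : 'I_n.-1) (c : R) :
  (forall O, S O -> \dim {:order_field O} = n) -> 0 < c ->
  (forall O, S O -> lambda R O k.+1 <= c * lambda R O i.+1 * lambda R O j.+1) ->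
  Spe R n S `<=` [set x : 'rV[R]_n.-1 | x 0 k <= x 0 i + x 0 j].
Proof.
move=> hn c0 hc x [S' [_ S'S inf typ]] /=; rewrite leNgt; apply/negP => hlt.
pose d := x 0 k - (x 0 i + x 0 j); have d0 : 0 < d by rewrite subr_gt0.
have [|D0 hD0] := typ (d / 8); first by rewrite divr_gt0.
(* Beyond [u0] the term [ln c / ln Delta] is at most [d / 8]. Together with the three coordinates
   the error is at most [d / 2], less than the violation [d]. *)
pose u0 := (8 * `|ln c| + 1) / d.
have u00 : 0 < u0 by rewrite divr_gt0 //; have := normr_ge0 (ln c); lra.
have [|O SO hO] := @Delta_unbounded R n S' _ inf (Num.max D0 (expR u0)).
  by move=> O /S'S; exact: hn.
move: hO; rewrite gt_max => /andP[hO1 hO2].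
have Dpos : 0 < Delta R O by apply: lt_trans hO2; exact: expR_gt0.
have hu : u0 < ln (Delta R O).
  by rewrite -[u0]expRK ltr_ln // posrE // expR_gt0.
have typO := hD0 O SO hO1.
have dimO := hn O (S'S O SO).
have lpos (m : 'I_n.-1) : 0 < lambda R O m.+1.
  apply: lt_le_trans ltr01 (lambda_ge1 R _); rewrite dimO; have := ltn_ord m; lia.
have hl : ln (lambda R O k.+1) <= ln c + ln (lambda R O i.+1) + ln (lambda R O j.+1).
  rewrite -!lnM ?posrE ?mulr_gt0 // ler_ln ?posrE ?mulr_gt0 //; exact: hc (S'S O SO).
have := typO i; have := typO j; have := typO k; rewrite /logb.
move: hl hu; move: (ln (lambda R O k.+1)) (ln (lambda R O i.+1)) (ln (lambda R O j.+1)).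
move: (ln (Delta R O)) => u lk li lj hl hu.
have u_gt0 : 0 < u by exact: lt_trans hu.
rewrite !ltr_norml => /andP[hk _] /andP[_ hj] /andP[_ hi].
have hcu : ln c / u <= d / 8.
  rewrite ler_pdivrMr //; move: hu; rewrite ltr_pdivrMr //.
  have := ler_norm (ln c); lra.
have : lk / u <= ln c / u + li / u + lj / u.
  by rewrite -!mulrDl ler_pM2r // invr_gt0.
rewrite /d in d0 hk hj hi hcu *; lra.
Qed.

Section Unbounded.
Variables (R : realType) (T : seq nat) (C : fieldExtType rat -> Prop).
Hypothesis hCiso : nf_iso_closed C.
Variable O : nf_order.
Notation n := (\dim {:order_field O}).
Notation lam := (lambda R O).
Hypothesis hO : orders_of_type R T C O.
Variables i j k : 'I_n.-1.

(* One order violating the inequality badly enough has a whole ray of dilations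
   whose Minkowski type violates the limiting inequality. *)
Lemma violating_family :
  4 * 8 ^+ n * (4 * n%:R ^+ 2) * lam i.+1 * lam j.+1 < lam k.+1 ->
  exists2 x : 'rV[R]_n.-1, Spe R n (orders_of_type R T C) x & x 0 i + x 0 j < x 0 k.
Proof.
move=> hlt; have [X [hX aX]] := adapted_basis R O.
have [A [A0 A_lt A_mul A_gap]] := weights_exist hX aX.
have n1 : (1 < n)%N by have := ltn_ord i; lia.
have S0 := weight_gt0 A0 A_lt n1.
have [c0 [b [B0 [OM hOM]]]] := dilated_family hX aX A0 A_lt A_mul.
set S := (\sum_(l < n) A l)%N in S0 hOM.
have AS l : (l < n)%N -> (A l <= S)%N.
  by move=> ln; rewrite /S (bigD1 (Ordinal ln)) //= leq_addr.
(* The limit of the quotients of logarithms is the quotient of their slopes in [dilated_family]. *)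
pose x : 'rV[R]_n.-1 := \row_m ((A m.+1)%:R / (2 * S)%:R).
have S2 : 0 < (2 * S)%:R :> R by rewrite ltr0n muln_gt0.
exists x; last first.
  rewrite !mxE -mulrDl ltr_pM2r ?invr_gt0 // -natrD ltr_nat.
  apply: A_gap hlt.
  - by have := ltn_ord i; lia.
  - by have := ltn_ord j; lia.
  - by have := ltn_ord k; lia.
clear hlt.
pose S' O' := exists2 M, (B0 <= M)%N & order_iso (OM M) O'.
exists S'; split.
- move=> O1 O2 h12 [M hM hiso]; exists M => //; exact: order_iso_trans hiso h12.
- move=> O' [M hM hiso]; have [h1 h2 _ _] := hOM M hM; split.
    by apply: hCiso (order_iso_nf_iso hiso) _; apply: hCiso h1 _; case: hO.
  by apply: (order_iso_tower hiso); apply: h2; case: hO.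
(* Finitely many classes would bound the discriminant by some [B], so [ln Delta < B]. The [M] chosen
   below makes [ln M.+1] at least [B + |c0|] and hence [ln Delta] at least [B]. *)
- move=> [m [f hf]].
  pose B : R := 1 + \sum_l `|Delta R (f l)|.
  have B0' : 0 < B by rewrite ltr_pwDl // sumr_ge0.
  have hB O' : S' O' -> Delta R O' <= B.
    move=> /hf[l hl]; rewrite (order_iso_Delta R hl) /B (bigD1 l) //= addrCA.
    apply: le_trans (ler_norm _) _; rewrite lerDl addr_ge0 // sumr_ge0 //.
  pose t := B + `|c0|; pose M := maxn B0 (Num.truncn (expR t)).
  have hM : (B0 <= M)%N by rewrite leq_maxl.
  have [_ _ [D0 eD] _] := hOM M hM.
  have h1 : Delta R (OM M) <= B by apply: hB; exists M => //; exact: order_iso_refl.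
  have h2 : ln (Delta R (OM M)) < B.
    by apply: le_lt_trans (ln_sublinear B0'); rewrite ler_ln ?posrE.
  have h3 : t <= ln M.+1%:R.
    rewrite -[t]expRK ler_ln ?posrE ?expR_gt0 ?ltr0n //.
    by apply: le_trans (ltW (truncnS_gt _)) _; rewrite ler_nat ltnS leq_maxr.
  have t0 : 0 <= t by rewrite addr_ge0 // ltW.
  have h4 : ln M.+1%:R <= (2 * S)%:R * ln M.+1%:R :> R.
    by rewrite ler_peMl ?(le_trans t0 h3) // ler1n muln_gt0.
  move: h2; rewrite eD ltNge => /negP; apply; rewrite -lerBlDl.
  by apply: le_trans (le_trans h3 h4); rewrite /t lerD2l -normrN ler_norm.
(* [Kc] bounds the distance of [ln lambda] from [x] times [ln Delta]: [b] comes from the estimate of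
   [lambda], and [|c0|] from expressing [ln M.+1] by [ln Delta], with a slope quotient at most 1.
   The maximum with 0 keeps [ln Delta] positive. *)
move=> eps eps0; pose Kc := b + `|c0|.
exists (expR (Num.max 0 (Kc / eps))) => O' [M hM hiso].
have [_ _ [D0 eD] hlam] := hOM M hM; rewrite (order_iso_Delta R hiso) => hD m.
rewrite (order_iso_lambda R hiso) /logb mxE.
have mn : (m.+1 < n)%N by have := ltn_ord m; lia.
have hu : Num.max 0 (Kc / eps) < ln (Delta R (OM M)).
  by rewrite -[Num.max _ _]expRK ltr_ln // posrE // expR_gt0.
move: hu; rewrite gt_max => /andP[u0 hu].
have := hlam m.+1 mn; have a0 := ler0n R (A m.+1).
have aS : (A m.+1)%:R <= (2 * S)%:R :> R.
  by rewrite ler_nat (leq_trans (AS _ mn)) // leq_pmull.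
set u := ln (Delta _ _) in u0 hu eD *; set L := ln (lambda _ _ _).
set a := (A m.+1)%:R in a0 aS *; set s := (2 * S)%:R in S2 eD aS *.
have eM : ln M.+1%:R = (u - c0) / s by rewrite eD addrC addKr mulrC mulKf // gt_eqF.
rewrite eM => h.
have as0 : 0 <= a / s by rewrite divr_ge0 // ltW.
have as1 : a / s <= 1 by rewrite ler_pdivrMr // mul1r.
have h' : `|L - a / s * u| <= Kc.
  have -> : L - a / s * u = (L - a * ((u - c0) / s)) - a / s * c0.
    by rewrite mulrBl mulrBr !mulrA [a * u / s]mulrAC [a * c0 / s]mulrAC opprB; ring.
  apply: le_trans (ler_normB _ _) _; rewrite lerD // normrM ger0_norm //.
  by rewrite ler_piMl.
have -> : L / u - a / s = (L - a / s * u) / u by rewrite mulrBl mulfK // gt_eqF.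
rewrite normrM normfV (gtr0_norm u0) ltr_pdivrMr //.
by apply: le_lt_trans h' _; rewrite mulrC -ltr_pdivrMr.
Qed.
End Unbounded.

Theorem theorem1p19 (R : realType) (n : nat) (T : seq nat)
    (hT : is_tower_type T) (hn : tower_degree T = n)
    (i j k : 'I_n.-1)
    (C : fieldExtType rat -> Prop) (hCiso : nf_iso_closed C)
    (hCdeg : forall K : fieldExtType rat, C K -> \dim {:K} = n) :
  Spe R n (orders_of_type R T C) `<=`
    [set x : 'rV[R]_n.-1 | x 0 k <= x 0 i + x 0 j]
  <->
  exists c : R, 0 < c /\
    forall O : nf_order, orders_of_type R T C O ->
      lambda R O k.+1 <= c * lambda R O i.+1 * lambda R O j.+1.
Proof.
have dimO O : orders_of_type R T C O -> \dim {:order_field O} = n.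
  by move=> [CO _]; exact: hCdeg.
split=> [hSpe|[c [c0 hc]]]; last exact: (spectrum_of_bound dimO c0 hc).
have n0 : (0 < n)%N by have := ltn_ord i; lia.
(* The threshold of [violating_family] depends on the degree only, so it serves all orders at
   once. *)
exists (4 * 8 ^+ n * (4 * n%:R ^+ 2)); split.
  by rewrite !mulr_gt0 // ?exprn_gt0 // ltr0n.
move=> O hO; rewrite leNgt; apply/negP; have := dimO O hO => dimK.
clear hn n0 hCdeg dimO; subst n => hlt.
have [x hx] := violating_family hCiso hO hlt.
by rewrite ltNge (hSpe x hx).
Qed.
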